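(* Let $p:\tilde G\to G$ be a free double cover of finite graphs, where $G$ has genus $g$. Then the order of the Prym group $\mathrm{Prym}(\tilde G/G)$ is $$|\mathrm{Prym}(\tilde G/G)|=\frac12\,|\mathrm{Ker}\,\mathrm{Nm}|=\sum_{r=1}^{g}4^{r-1}C_r,$$ where $\mathrm{Nm}:\mathrm{Jac}(\tilde G)\to \mathrm{Jac}(G)$ is the norm map and $C_r$ is the number of odd genus one decompositions of $G$ of rank $r$.
   Context: Graphs are finite, may have loops and multi-edges, and all graphs (in particular both $G$ and $\tilde G$) are assumed connected. The genus is $g(G)=|E(G)|-|V(G)|+1$. A free double cover $p:\tilde G\to G$ is a topological covering of degree two: $p$ consists of surjective 2-to-1 maps on vertices and on edges that preserve adjacency and are isomorphisms in a neighbourhood of every vertex of $\tilde G$. Let $\iota:\tilde G\to\tilde G$ be the involution exchanging the sheets. For a graph $G$: $\mathrm{Div}(G)$ is the free abelian group on $V(G)$; the Laplacian is $L=Q-A$, where $Q$ is the diagonal matrix of valencies (a loop counts twice) and $A$ is the adjacency matrix (for a loop at $v$, the contribution to $A_{vv}$ is such that rows of $L$ sum to zero); principal divisors are the image of $-L:\mathbb{Z}^{V(G)}\to \mathbb{Z}^{V(G)}=\mathrm{Div}(G)$; $\mathrm{Jac}(G)=\mathrm{Div}^0(G)/\mathrm{Prin}(G)$. The norm map $\mathrm{Nm}(\sum a_v v)=\sum a_v p(v)$ on divisors descends to a surjective homomorphism $\mathrm{Nm}:\mathrm{Jac}(\tilde G)\to \mathrm{Jac}(G)$. A divisor $D\in\mathrm{Div}(\tilde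 G)$ with $\mathrm{Nm}(D)=0$ in $\mathrm{Div}(G)$ can be written uniquely as $D=E-\iota(E)$ with $E$ effective and $E,\iota(E)$ of disjoint support; its parity is $\epsilon(D)=\deg E \bmod 2$. Parity is additive and invariant under linear equivalence, so gives a surjective homomorphism from the kernel of $\mathrm{Nm}:\mathrm{Jac}(\tilde G)\to \mathrm{Jac}(G)$ to $\mathbb{Z}/2\mathbb{Z}$ (each class in this kernel has a representative with trivial norm in $\mathrm{Div}(G)$). The Prym group $\mathrm{Prym}(\tilde G/G)\subset\mathrm{Jac}(\tilde G)$ is the subgroup of even classes in $\mathrm{Ker}\,\mathrm{Nm}$. A set $F\subset E(G)$ of $g-1$ edges is an odd genus one decomposition of rank $r$ if $G\setminus F$ (edges of $F$ removed, all vertices kept) has exactly $r$ connected components, each of genus one, and the preimage in $\tilde G$ of each of these components is connected. *)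

(* Defs.v *)
From HB Require Import structures.
From mathcomp Require Import boolp classical_sets functions cardinality.
From mathcomp Require Import all_boot all_order all_algebra.
From mathcomp Require Import generic_quotient ring_quotient.

Set Implicit Arguments.
Unset Strict Implicit.
Unset Printing Implicit Defensive.

Import GRing.Theory Num.Theory.

Local Open Scope ring_scope.
Local Open Scope quotient_scope.

(* Finite multigraphs in the sense of Serre: an edge is an orbit {h, flip h} of
   a fixed-point-free involution on the half-edges.  Loops are the edges with
   root h = root (flip h). *)
Record mgraph := MGraph {
  vert : finType;
  hedge : finType;
  root : hedge -> vert;
  flip : hedge -> hedge;
  flipK : involutive flip;
  flip_neq : forall h, flip h != h
}.

Arguments root {m} _.
Arguments flip {m} _.

Definition edge_of (G : mgraph) (h : hedge G) : {set hedge G} :=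
  [set h; flip h]%SET.

Definition edges (G : mgraph) : {set {set hedge G}} :=
  [set edge_of h | h : hedge G]%SET.

(* In what follows, a subgraph is a pair of a set U of vertices and a set A of
   edges. *)
Definition adj (G : mgraph) (U : {set vert G}) (A : {set {set hedge G}}) :
    rel (vert G) :=
  fun u v => [&& u \in U, v \in U &
    [exists h : hedge G, [&& edge_of h \in A, root h == u & root (flip h) == v]]].

Definition sub_connected (G : mgraph) (U : {set vert G})
    (A : {set {set hedge G}}) : bool :=
  (U != set0)%SET && [forall u in U, forall v in U, connect (adj U A) u v].

(* The subtraction is truncated, but |E| + 1 - |V| >= 0 for connected graphs. *)
Definition sub_genus (G : mgraph) (U : {set vert G})
    (A : {set {set hedge G}}) : nat :=
  (#|A|.+1 - #|U|)%N.

Definition connected (G : mgraph) : bool := sub_connected [set: vert G] (edges G).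

Definition genus (G : mgraph) : nat := sub_genus [set: vert G] (edges G).

Definition components (G : mgraph) (A : {set {set hedge G}}) :
    {set {set vert G}} :=
  equivalence_partition (connect (adj [set: vert G] A)) [set: vert G].

Definition edges_in (G : mgraph) (A : {set {set hedge G}}) (U : {set vert G}) :
    {set {set hedge G}} :=
  [set e in A | [forall h in e, root h \in U]]%SET.

(* pH_local says that p is a local isomorphism at every vertex; pE_two concerns
   the induced map f |-> pH @: f on edges. *)
Record free_double_cover (Gt G : mgraph) := FreeDoubleCover {
  pV : vert Gt -> vert G;
  pH : hedge Gt -> hedge G;
  pH_root : forall k, root (pH k) = pV (root k);
  pH_flip : forall k, pH (flip k) = flip (pH k);
  pH_local : forall (u : vert Gt) (h : hedge G), root h = pV u ->
    exists! k : hedge Gt, root k = u /\ pH k = h;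
  pV_two : forall v : vert G, #|[set u | pV u == v]%SET| = 2%N;
  pE_two : forall e : {set hedge G}, e \in edges G ->
    #|[set f in edges Gt | (pH @: f)%SET == e]%SET| = 2%N
}.

(* The other vertex in the fibre of u. *)
Definition sheet_swap (Gt G : mgraph) (p : free_double_cover Gt G)
    (u : vert Gt) : vert Gt :=
  odflt u [pick w | (pV p w == pV p u) && (w != u)].

Definition Div (G : mgraph) := {ffun vert G -> int}.
HB.instance Definition _ (G : mgraph) := GRing.Zmodule.on (Div G).

Definition deg (G : mgraph) (D : Div G) : int := \sum_v D v.

Definition deg0 (G : mgraph) : {pred Div G} := fun D => deg D == 0.

Fact deg0_zmod_closed (G : mgraph) : zmod_closed (@deg0 G).
Proof.
split=> [|D D']; rewrite !unfold_in /deg0 /deg.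
  by rewrite big1 // => v _; rewrite ffunE.
move=> /eqP dD /eqP dD'; rewrite (eq_bigr (fun v => D v - D' v)).
  by rewrite sumrB dD dD' subr0.
by move=> v _; rewrite !ffunE.
Qed.

HB.instance Definition _ (G : mgraph) :=
  GRing.isZmodClosed.Build (Div G) (@deg0 G) (@deg0_zmod_closed G).

Record Div0 (G : mgraph) := MkDiv0 {
  div0_val :> Div G;
  div0P : div0_val \in @deg0 G
}.
HB.instance Definition _ (G : mgraph) := [isSub for @div0_val G].
HB.instance Definition _ (G : mgraph) := [Choice of Div0 G by <:].
HB.instance Definition _ (G : mgraph) := [SubChoice_isSubZmodule of Div0 G by <:].

Definition valency (G : mgraph) (v : vert G) : nat :=
  #|[set h : hedge G | root h == v]%SET|.

(* The half-edge count makes a loop at v contribute 2 to adjacency v v. *)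
Definition adjacency (G : mgraph) (v w : vert G) : nat :=
  #|[set h : hedge G | (root h == v) && (root (flip h) == w)]%SET|.

Definition laplacian (G : mgraph) (v w : vert G) : int :=
  (valency v)%:Z *+ (v == w) - (adjacency v w)%:Z.

Definition prin_div (G : mgraph) (f : {ffun vert G -> int}) : Div G :=
  [ffun v => - \sum_w laplacian v w * f w].

Definition prin0 (G : mgraph) : {pred Div0 G} :=
  fun D => `[< exists f : {ffun vert G -> int}, div0_val D = prin_div f >].

Lemma prin_divB (G : mgraph) (f g : {ffun vert G -> int}) :
  prin_div (f - g) = prin_div f - prin_div g.
Proof.
apply/ffunP => v; rewrite !ffunE -opprD; congr (- _).
by rewrite -sumrB; apply: eq_bigr => w _; rewrite !ffunE mulrBr.
Qed.

Fact prin0_zmod_closed (G : mgraph) : zmod_closed (@prin0 G).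
Proof.
split=> [|D D']; rewrite !unfold_in /prin0.
  apply/asboolP; exists 0; apply/ffunP => v; rewrite !ffunE big1 ?oppr0 //.
  by move=> w _; rewrite ffunE mulr0.
move=> /asboolP [f Df] /asboolP [g Dg]; apply/asboolP; exists (f - g).
by rewrite prin_divB -Df -Dg.
Qed.

HB.instance Definition _ (G : mgraph) :=
  GRing.isZmodClosed.Build (Div0 G) (@prin0 G) (@prin0_zmod_closed G).

Definition Jac (G : mgraph) : zmodType := Quotient.quot (@prin0 G).

Definition jac_class (G : mgraph) (D : Div0 G) : Jac G := \pi_(Quotient.quot (@prin0 G)) D.

Section Norm.
Variables (Gt G : mgraph) (p : free_double_cover Gt G).

Definition NmDiv (D : Div Gt) : Div G := [ffun v => \sum_(u | pV p u == v) D u].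

Lemma deg_NmDiv (D : Div Gt) : deg (NmDiv D) = deg D.
Proof.
rewrite /deg [RHS](partition_big (pV p) xpredT) //=.
by apply: eq_bigr => v _; rewrite ffunE.
Qed.

Fact NmDiv_deg0 (D : Div0 Gt) : NmDiv D \in @deg0 G.
Proof. by case: D => D /=; rewrite !unfold_in /deg0 deg_NmDiv. Qed.

Definition NmDiv0 (D : Div0 Gt) : Div0 G := MkDiv0 (NmDiv_deg0 D).

Definition Nm (x : Jac Gt) : Jac G := jac_class (NmDiv0 (repr (x : Quotient.quot (@prin0 Gt)))).


Lemma card_star (u : vert Gt) (P : pred (hedge G)) :
  #|[set k | (root k == u) && P (pH p k)]%SET| =
  #|[set h | (root h == pV p u) && P h]%SET|.
Proof.
have inj : {in [set k | (root k == u) && P (pH p k)]%SET &, injective (pH p)}.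
  move=> k k'; rewrite !inE => /andP[/eqP ku _] /andP[/eqP k'u _] e.
  have hr : root (pH p k) = pV p u by rewrite pH_root ku.
  have [k0 [_ uniq0]] := pH_local hr.
  by rewrite -(uniq0 k (conj ku erefl)) (uniq0 k' (conj k'u (esym e))).
rewrite -(card_in_imset inj); congr #|pred_of_set _|.
apply/setP => h; rewrite !inE; apply/imsetP/andP => [[k]|[/eqP hu Ph]].
  by rewrite inE => /andP[/eqP ku Pk] ->; rewrite pH_root ku.
have [k [[ku kh] _]] := pH_local hu.
by exists k; rewrite ?inE ?kh ?ku ?eqxx.
Qed.

Lemma valency_cover (u : vert Gt) : valency u = valency (pV p u).
Proof.
by apply: etrans (etrans (card_star u xpredT) _);
  apply: eq_card => k; rewrite !inE andbT.
Qed.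

Lemma adjacencyC (H : mgraph) (v w : vert H) : adjacency v w = adjacency w v.
Proof.
rewrite /adjacency -(card_imset _ (inv_inj (@flipK H))).
rewrite (can_imset_pre _ (@flipK H)); apply: eq_card => h.
by rewrite !inE flipK andbC.
Qed.

Lemma adjacency_cover (w : vert Gt) (v : vert G) :
  (\sum_(u | pV p u == v) adjacency u w)%N = adjacency v (pV p w).
Proof.
rewrite [RHS]adjacencyC /adjacency.
rewrite -(card_star w (fun h => root (flip h) == v)).
rewrite -sum1_card (partition_big (fun k => root (flip k)) (fun u => pV p u == v)) /=; last first.
  by move=> k; rewrite !inE -pH_flip pH_root => /andP[].
apply: eq_bigr => u /eqP uv; rewrite -[LHS]/(adjacency u w) adjacencyC /adjacency -sum1_card.
apply: eq_bigl => k; rewrite !inE -pH_flip pH_root.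
by case: (root (flip k) =P u) => [->|_]; rewrite ?uv ?eqxx ?andbF ?andbT.
Qed.

Lemma NmDiv_prin (f : {ffun vert Gt -> int}) :
  NmDiv (prin_div f) = prin_div (NmDiv f).
Proof.
apply/ffunP => v; rewrite !ffunE.
rewrite (eq_bigr (fun u => - \sum_w laplacian u w * f w)); last first.
  by move=> u _; rewrite ffunE.
rewrite sumrN; congr (- _); rewrite exchange_big /=.
rewrite (partition_big (pV p) xpredT) //=; apply: eq_bigr => v' _.
rewrite ffunE big_distrr /=; apply: eq_bigr => w /eqP wv'.
rewrite -big_distrl /=; congr (_ * _); rewrite sumrB; congr (_ - _); last first.
  under eq_bigr do rewrite -natz.
  by rewrite -natr_sum natz adjacency_cover wv'.
case: (v =P v') => [vv'|nvv'].
  rewrite (bigD1 w) /= ?wv' ?vv' // eqxx valency_cover wv' big1 ?addr0 //.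
  by move=> u /andP[_ /negPf ->].
rewrite big1 // => u /eqP uv; case: eqP => // uw.
by case: nvv'; rewrite -uv -wv' uw.
Qed.

Lemma NmDivB (D D' : Div Gt) : NmDiv (D - D') = NmDiv D - NmDiv D'.
Proof.
by apply/ffunP => v; rewrite !ffunE -sumrB; apply: eq_bigr => u _; rewrite !ffunE.
Qed.

(* Nm is defined through the canonical representative of a class; this is the
   independence of the representative. *)
Lemma Nm_class (D : Div0 Gt) : Nm (jac_class D) = jac_class (NmDiv0 D).
Proof.
apply/eqP; rewrite /Nm /jac_class -Quotient.idealrBE.
set D' := repr _.
have : D' - D \in @prin0 Gt by rewrite Quotient.idealrBE reprK.
rewrite !unfold_in /prin0 => /asboolP[f Df]; apply/asboolP; exists (NmDiv f).
by rewrite -NmDiv_prin -Df /= NmDivB.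
Qed.

Definition KerNm : set (Jac Gt) := [set x | Nm x = 0]%classic.

Definition effective (D : Div Gt) : Prop := forall u, 0 <= D u.

Definition iota_div (D : Div Gt) : Div Gt := [ffun u => D (sheet_swap p u)].

Definition disjoint_support (D D' : Div Gt) : Prop :=
  forall u, D u = 0 \/ D' u = 0.

(* A divisor D of trivial norm is uniquely D = E - iota E with E effective and
   E, iota E of disjoint support; its parity is deg E mod 2. *)
Definition has_parity (D : Div Gt) (b : bool) : Prop :=
  exists E : Div Gt, [/\ effective E, disjoint_support E (iota_div E),
    D = E - iota_div E & b = odd `|deg E|%N].

Definition Prym : set (Jac Gt) :=
  [set x | KerNm x /\ exists D : Div0 Gt,
    [/\ jac_class D = x, NmDiv D = 0 & has_parity D false]]%classic.

End Norm.

Section OddGenusOne.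
Variables (Gt G : mgraph) (p : free_double_cover Gt G).

Definition preim_edges (A : {set {set hedge G}}) : {set {set hedge Gt}} :=
  [set f in edges Gt | (pH p @: f)%SET \in A]%SET.

Definition preim_connected (U : {set vert G}) (A : {set {set hedge G}}) : bool :=
  sub_connected (pV p @^-1: U)%SET (preim_edges A).

Definition odd_genus_one_decomp (r : nat) (F : {set {set hedge G}}) : bool :=
  let A := (edges G :\: F)%SET in
  [&& F \subset edges G,
      (#|F|.+1 == genus G)%N,
      #|components A| == r &
      [forall U in components A,
         (sub_genus U (edges_in A U) == 1%N) && preim_connected U (edges_in A U)]].

Definition num_odd_genus_one_decomp (r : nat) : nat :=
  #|[set F | odd_genus_one_decomp r F]%SET|.

End OddGenusOne.

(* Main.v *)
From mathcomp Require Import boolp classical_sets functions cardinality.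
From mathcomp Require Import all_boot all_order all_algebra zify perm.
From mathcomp Require Import generic_quotient ring_quotient.
Require Import Defs.

(** Choose a section of the cover over the vertices.  A divisor of trivial norm on the
cover is the anti-invariant lift of an integer vector x on the vertices of G, and the
Laplacian of the cover acts on such vectors as a signed Laplacian of G, in which the edges
whose lifts change sheet enter with the opposite sign (prin_div_lift).

Every class in Ker Nm is represented by some x (KerNmP).  Two vectors give the same class
when they differ by an element of the lattice spanned by the signed Laplacian and one
further vector, half_shift, which comes from the indicator function of a sheet
(lift_class_eq).  That vector lies outside the image of the signed Laplacian because the
cover is connected, so the cokernel of the signed Laplacian maps two-to-one onto Ker Nm.
Parity is the parity of the sum of the coordinates of x; it splits the cokernel in two
halves, and the even half maps two-to-one onto the Prym group (card_KerNm_Prym).  It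
remains to see that the cokernel has four times as many elements as the sum in the
theorem.

By the Smith normal form the order of the cokernel is the determinant (index_det), and the
signed Laplacian is N N^T for the signed incidence matrix N, so by the Cauchy-Binet formula
this determinant is the sum of the squares of the maximal minors of N (det_gram).  Such a
minor belongs to a set B of as many edges as there are vertices.  If some component of B
has a disconnected preimage, the difference of the indicators of the two halves of that
preimage lies in the kernel and the minor vanishes (det_incidence_untwisted).  Otherwise
the minor is nonzero, and its columns span the lattice of vectors having an even sum on
every component, so that its absolute value is 2^r for r components
(det_incidence_twisted).  Finally, these sets B are precisely the complements of the odd
genus one decompositions: as N has a nonzero minor on B, each component has at least as
many edges as vertices, so all components have genus one (odd_genus_one_decompE). *)

Set Implicit Arguments.
Unset Strict Implicit.
Unset Printing Implicit Defensive.

Import Order.TTheory GRing.Theory Num.Theory.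

Local Open Scope ring_scope.

(** * Index of the image of an integer matrix *)

(** The cosets of a subgroup are presented by a labelling phi rather than by a quotient
type: only their number and a choice of representatives are needed. *)
Definition has_index (A : zmodType) (P : A -> Prop) (n : nat) : Prop :=
  exists2 phi : A -> 'I_n, (forall i, exists x, phi x = i) &
    forall x y, phi x = phi y <-> P (x - y).

(** Choosing representatives of the f-classes embeds them in the g-classes. *)
Lemma surjective_card_leq (A : Type) (m n : nat) (f : A -> 'I_m) (g : A -> 'I_n) :
  (forall i, exists x, f x = i) ->
  (forall x y, g x = g y -> f x = f y) -> (m <= n)%N.
Proof.
elim: m n f g => // m IH [|n] f g fS fg; first by case: (fS ord0) => x; case: (g x).
rewrite -[m.+1]card_ord -[n.+1]card_ord.
have [r fr] := fin_all_exists fS.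
apply: (@leq_card _ _ (g \o r)) => i j /= e.
by rewrite -(fr i) -(fr j); apply: fg.
Qed.

Lemma has_index_inj (A : zmodType) (P : A -> Prop) (m n : nat) :
  has_index P m -> has_index P n -> m = n.
Proof.
move=> [f fS fP] [g gS gP]; apply/eqP; rewrite eqn_leq; apply/andP; split.
  by apply: (surjective_card_leq fS (g := g)) => x y /gP/fP.
by apply: (surjective_card_leq gS (g := f)) => x y /fP/gP.
Qed.

Lemma has_index_set (A : zmodType) (P : A -> Prop) (T : finType) (X : {set T})
    (phi : A -> T) :
  (forall x, phi x \in X) -> (forall t, t \in X -> exists x, phi x = t) ->
  (forall x y, phi x = phi y <-> P (x - y)) -> has_index P #|X|.
Proof.
move=> phX phS phP.
exists (fun x => enum_rank_in (phX 0) (phi x)).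
  move=> i; have [x xi] := phS _ (enum_valP i).
  by exists x; rewrite xi enum_valK_in.
move=> x y; apply: iff_trans (phP x y); split=> [|-> //].
by move/(congr1 enum_val); rewrite !enum_rankK_in.
Qed.

Lemma abs_unitmx_det n (L : 'M[int]_n) : L \in unitmx -> `|\det L|%N = 1%N.
Proof. by rewrite unitmxE => /orP[] /eqP ->. Qed.

(** After the unimodular changes of basis of the Smith normal form L D R the lattice is
spanned by multiples of the basis vectors, so a coset is a vector of residues modulo the
diagonal entries, and det M is their product up to sign. *)
Lemma index_det n (M : 'M[int]_n) : \det M != 0 ->
  has_index (fun x : 'cV[int]_n => exists z, x = M *m z) `|\det M|%N.
Proof.
have [L uL [R uR [d _ ->]]] := int_Smith_normal_form M.
pose a (i : 'I_n) : int := d`_i; set D := \matrix_(i, j) _.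
have DE : D = diag_mx (\row_i a i).
  by apply/matrixP => i j; rewrite !mxE -val_eqE.
have -> : `|\det (L *m D *m R)|%N = (\prod_(i < n) `|a i|)%N.
  rewrite !det_mulmx !abszM (abs_unitmx_det uL) (abs_unitmx_det uR) mul1n muln1.
  rewrite DE det_diag (big_morph absz abszM (erefl _)).
  by apply: eq_bigr => i _; rewrite mxE.
rewrite !det_mulmx !mulf_eq0 DE det_diag negb_or => /andP[]; rewrite negb_or.
move=> /andP[_ /prodf_neq0 dn0] _.
have {dn0} d0 i : i \in 'I_n -> a i != 0 by move=> _; have := dn0 i isT; rewrite mxE.
pose K := (\sum_(i < n) `|a i|)%N.
have dK (i : 'I_n) : (`|a i| <= K)%N by rewrite /K (bigD1 i) //= leq_addr.
pose X := [set t : {ffun 'I_n -> 'I_K.+1} | [forall i, (t i < `|a i|)%N]].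
have modlt (i : 'I_n) (b : int) : (`|(b %% a i)%Z| < `|a i|)%N.
  have := ltz_mod b (d0 i isT); have := modz_ge0 b (d0 i isT).
  by case: (_ %% _)%Z; case: (a i).
pose phi (x : 'cV[int]_n) :=
  [ffun i : 'I_n => (inord `|((invmx L *m x)%R i 0%R %% a i)%Z| : 'I_K.+1)].
have phiE x i : phi x i = `|((invmx L *m x)%R i 0%R %% a i)%Z|%N :> nat.
  by rewrite ffunE inordK // ltnS (leq_trans (ltnW (modlt _ _))).
have -> : (\prod_(i < n) `|a i|)%N = #|X|.
  transitivity #|family (fun i : 'I_n => [pred j : 'I_K.+1 | (j < `|a i|)%N])|.
    rewrite card_family foldrE big_map big_enum.
    apply: eq_bigr => i _ /=; rewrite -[LHS]card_ord.
    have inj : injective (widen_ord (leqW (dK i))) by move=> j k /(congr1 val) /= /val_inj.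
    rewrite -(card_codom inj); apply: eq_card => j.
    apply/codomP/idP => [[k ->]|ji]; first exact: (ltn_ord k).
    by exists (Ordinal (ji : (j < `|a i|)%N)); apply: val_inj.
  apply: eq_card => t; rewrite [RHS]inE.
  by apply/familyP/forallP => h i; have := h i; rewrite ?inE.
apply: (has_index_set (phi := phi)).
- by move=> x; rewrite inE; apply/forallP => i; rewrite phiE.
- move=> t; rewrite inE => /forallP tX; exists (L *m \col_i (t i : nat)%:Z).
  apply/ffunP => i; apply: val_inj; rewrite /= phiE mulKmx // mxE -modz_abs.
  rewrite modz_small ?absz_nat // lez_nat leq0n ltz_nat; exact: tX.
move=> x y; split=> [e|[z zE]].
  have dvd i : (a i %| ((invmx L *m (x - y))%R i 0%R))%Z.
    have := congr1 (fun t : {ffun 'I_n -> 'I_K.+1} => t i : nat) e.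
    rewrite !phiE => /(congr1 Posz).
    rewrite !abszE !ger0_norm ?modz_ge0 ?d0 // => /eqP.
    by rewrite eqz_mod_dvd mulmxBr !mxE.
  exists (invmx R *m \col_i ((invmx L *m (x - y))%R i 0%R %/ a i)%Z).
  rewrite -!mulmxA mulKVmx //; apply: (canRL (mulKVmx uL)).
  apply/matrixP => i j; rewrite ord1 mul_diag_mx !mxE mulrC divzK //.
  by have := dvd i; rewrite !mxE.
apply/ffunP => i; apply: val_inj; rewrite /= !phiE; congr `|_|%N.
apply/eqP; rewrite eqz_mod_dvd.
have -> : (invmx L *m x) i 0 - (invmx L *m y) i 0 = (invmx L *m (x - y)) i 0.
  by rewrite mulmxBr !mxE.
by rewrite zE -!mulmxA mulKmx // mul_diag_mx !mxE dvdz_mulr.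
Qed.

Definition col_submx (V W : finType) (f : 'I_#|V| -> W) (R : Type)
    (M : V -> W -> R) : 'M[R]_#|V| :=
  \matrix_(i, j) M (enum_val i) (f j).

Lemma index_col_submx (V W : finType) (f : {ffun 'I_#|V| -> W}) (M : V -> W -> int) :
  \det (col_submx f M) != 0 ->
  has_index (fun x : {ffun V -> int} =>
    exists z : 'I_#|V| -> int, forall v, x v = \sum_j M v (f j) * z j)
    `|\det (col_submx f M)|%N.
Proof.
move=> /index_det [phi phS phP].
pose c (x : {ffun V -> int}) : 'cV[int]_#|V| := \col_i x (enum_val i).
exists (fun x => phi (c x)).
  move=> i; have [y yi] := phS i; exists [ffun v => y (enum_rank v) 0].
  by rewrite -yi; congr phi; apply/matrixP => a b; rewrite ord1 !mxE ffunE enum_valK.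
move=> x y; apply: iff_trans (phP _ _) _; split=> -[z zE].
  exists (fun j => z j 0) => v.
  have := congr1 (fun A : 'cV[int]__ => A (enum_rank v) 0) zE.
  rewrite !mxE enum_rankK !ffunE => ->.
  by apply: eq_bigr => j _; rewrite mxE enum_rankK.
exists (\col_j z j); apply/matrixP => i k; rewrite ord1 !mxE.
have := zE (enum_val i); rewrite !ffunE => ->.
by apply: eq_bigr => j _; rewrite !mxE.
Qed.

(** * The Cauchy-Binet formula for Gram determinants *)

Lemma det_mul_sum_rows (R : comPzRingType) n (E : finType)
    (A : 'I_n -> E -> R) (B : E -> 'I_n -> R) :
  \det (\matrix_(i, j) \sum_e A i e * B e j) =
  \sum_(f : {ffun 'I_n -> E}) (\prod_i A i (f i)) * \det (\matrix_(i, j) B (f i) j).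
Proof.
pose AB (s : 'S_n) i e := A i e * B e (s i).
transitivity (\sum_(f : {ffun 'I_n -> E}) \sum_(s : 'S_n) (-1) ^+ s * \prod_i AB s i (f i)).
  rewrite exchange_big; apply: eq_bigr => /= s _; rewrite -big_distrr /=.
  congr (_ * _); rewrite -(bigA_distr_bigA (AB s)) /=.
  by apply: eq_bigr => x _; rewrite mxE.
apply: eq_bigr => f _; rewrite big_distrr /=; apply: eq_bigr => s _.
rewrite big_split /= mulrCA; congr (_ * (_ * _)).
by apply: eq_bigr => x _; rewrite mxE.
Qed.

(** Cauchy-Binet with repetition: each n-element set of columns is counted once for each
of its n! orderings, and non-injective f contribute zero.  Averaging the row expansion
over all permutations of the factors turns the product of entries of A into a
determinant. *)
Lemma cauchy_binet (R : comPzRingType) n (E : finType)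
    (A : 'I_n -> E -> R) (B : E -> 'I_n -> R) :
  n`!%:R * \det (\matrix_(i, j) \sum_e A i e * B e j) =
  \sum_(f : {ffun 'I_n -> E})
    \det (\matrix_(i, j) A i (f j)) * \det (\matrix_(i, j) B (f i) j).
Proof.
transitivity (\sum_(s : 'S_n) \sum_(f : {ffun 'I_n -> E})
   (\prod_i A i (f (s i))) * ((-1) ^+ s * \det (\matrix_(i, j) B (f i) j))).
  rewrite -card_Sn -sum1_card natr_sum big_distrl /=.
  rewrite (eq_bigl xpredT) => [|s]; last by rewrite inE.
  apply: eq_bigr => s _; rewrite mul1r det_mul_sum_rows.
  pose act (t : 'S_n) (f : {ffun 'I_n -> E}) := [ffun i => f (t i)].
  have actK : bijective (act s).
    by exists (act s^-1%g) => f; apply/ffunP => i; rewrite !ffunE ?permK ?permKV.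
  rewrite (reindex (act s)); last exact: onW_bij.
  apply: eq_bigr => f _; congr (_ * _).
    by apply: eq_bigr => i _; rewrite ffunE.
  rewrite -det_perm -det_mulmx -row_permE; congr (\det _).
  by apply/matrixP => i j; rewrite !mxE ffunE.
rewrite exchange_big /=; apply: eq_bigr => f _.
rewrite big_distrl /=; apply: eq_bigr => s _.
rewrite mulrA [_ * (-1) ^+ s]mulrC; congr (_ * _ * _).
by apply: eq_bigr => i _; rewrite !mxE.
Qed.

Lemma sum_inj_ffun (R : pzSemiRingType) n (E : finType)
    (F : {ffun 'I_n -> E} -> R) (w : {set E} -> R) :
  (forall f : {ffun 'I_n -> E}, ~~ injectiveb f -> F f = 0) ->
  (forall f : {ffun 'I_n -> E}, injectiveb f -> F f = w [set f i | i : 'I_n]) ->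
  \sum_f F f = n`!%:R * \sum_(S : {set E} | #|S| == n) w S.
Proof.
move=> F0 Fw; rewrite (bigID (fun f : {ffun 'I_n -> E} => injectiveb f)) /= addrC.
rewrite big1 ?add0r; last exact: F0.
rewrite (partition_big (fun f : {ffun 'I_n -> E} => [set f i | i : 'I_n])
          (fun S => #|S| == n)) /=; last first.
  by move=> f /injectiveP injf; rewrite card_imset // card_ord.
rewrite big_distrr /=; apply: eq_bigr => S /eqP Sn.
rewrite (eq_bigr (fun=> w S)); last by move=> f /andP[injf /eqP <-]; apply: Fw.
rewrite sumr_const -[LHS]mulr_natl; congr (_%:R * _).
rewrite -ffactnn; transitivity (#|S| ^_ #|'I_n|)%N; last by rewrite Sn card_ord.
rewrite -card_inj_ffuns_on.
apply: eq_card => f; rewrite [RHS]inE unfold_in.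
case injf: (injectiveb f); rewrite /= ?andbT ?andbF //.
apply/eqP/ffun_onP => [<- i|fS]; first by rewrite imset_f.
apply/eqP; rewrite eqEcard; apply/andP; split.
  by apply/subsetP => e /imsetP[i _ ->].
by rewrite card_imset ?card_ord ?Sn //; apply/injectiveP.
Qed.

(** The square of a maximal minor depends only on the set of columns, not on their order,
so the n! of the Cauchy-Binet formula cancels. *)
Lemma det_gram (V E : finType) (N : V -> E -> int) (w : {set E} -> int) :
  (forall f : {ffun 'I_#|V| -> E}, injective f ->
     \det (col_submx f N) ^+ 2 = w [set f i | i : 'I_#|V|]) ->
  \det (\matrix_(i < #|V|, j < #|V|) \sum_e N (enum_val i) e * N (enum_val j) e) =
  \sum_(S : {set E} | #|S| == #|V|) w S.
Proof.
move=> Nw; have n0 : ((#|V|)`!%:R : int) != 0 by rewrite pnatr_eq0 -lt0n fact_gt0.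
apply: (mulfI n0).
rewrite (cauchy_binet (fun i e => N (enum_val i) e) (fun e j => N (enum_val j) e)).
transitivity (\sum_(f : {ffun 'I_#|V| -> E}) \det (col_submx f N) ^+ 2).
  apply: eq_bigr => f _; rewrite expr2; congr (_ * _).
  by rewrite -det_tr; congr (\det _); apply/matrixP => i j; rewrite !mxE.
apply: sum_inj_ffun => [f|f /injectiveP]; last exact: Nw.
move=> /injectivePn[i [j ij fij]]; rewrite -det_tr (determinant_alternate ij) ?expr0n //.
by move=> k; rewrite !mxE fij.
Qed.

(** * Connectivity and the Laplacian of a multigraph *)

Lemma connect_ind (T : finType) (e : rel T) (P : T -> Prop) :
  (forall a b, e a b -> P a -> P b) -> forall x y, connect e x y -> P x -> P y.
Proof.
move=> eP x y /connectP[q]; elim: q x => [|z q IH] x /=; first by move=> _ ->.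
by move=> /andP[xz qz] yE /(eP _ _ xz); apply: IH.
Qed.

Section Graph.
Variable G : mgraph.
Implicit Types (U : {set vert G}) (A : {set {set hedge G}}) (h : hedge G).

Lemma edge_of_flip h : edge_of (flip h) = edge_of h.
Proof. by rewrite /edge_of flipK setUC. Qed.

Lemma edge_ofP h h' : edge_of h = edge_of h' -> h' = h \/ h' = flip h.
Proof.
move=> e; have : h' \in edge_of h by rewrite e !inE eqxx.
by rewrite !inE => /orP[] /eqP ->; [left|right].
Qed.

Lemma edge_of_edges h : edge_of h \in edges G.
Proof. exact: imset_f. Qed.

(** The pick orients the edge e; it fails exactly when e is not the underlying set of an
edge. *)
Lemma sum_hedges (R : zmodType) (F : hedge G -> R) :
  \sum_h F h =
  \sum_e if [pick h | edge_of h == e] is Some h then F h + F (flip h) else 0.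
Proof.
rewrite (partition_big (@edge_of G) xpredT) //=; apply: eq_bigr => e _.
case: pickP => [h0 /eqP eh0|none]; last by rewrite big_pred0.
rewrite (bigD1 h0) /= ?eh0 // (bigD1 (flip h0)) /=; last first.
  by rewrite edge_of_flip eh0 eqxx flip_neq.
rewrite big1 ?addr0 // => h /andP[/andP[/eqP eh]].
by rewrite -eh0 in eh; case: (edge_ofP (esym eh)) => ->; rewrite eqxx.
Qed.

Lemma adj_sym U A : symmetric (adj U A).
Proof.
move=> u v; rewrite /adj andbCA; congr [&& _, _ & _].
by apply/existsP/existsP => -[h /and3P[hA hu hv]]; exists (flip h);
  rewrite edge_of_flip flipK hA hu hv.
Qed.

Lemma adj_connect_sym U A : connect_sym (adj U A).
Proof. exact/sym_connect_sym/adj_sym. Qed.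

Lemma adjT_edge A h : edge_of h \in A -> adj setT A (root h) (root (flip h)).
Proof. by move=> hA; rewrite /adj !inE; apply/existsP; exists h; rewrite hA !eqxx. Qed.

Lemma adjTP A u v : adj setT A u v ->
  exists h, [/\ edge_of h \in A, root h = u & root (flip h) = v].
Proof. by rewrite /adj !inE => /existsP[h /and3P[hA /eqP hu /eqP hv]]; exists h. Qed.

Lemma prin_divE (f : {ffun vert G -> int}) v :
  prin_div f v = \sum_(h | root h == v) (f (root (flip h)) - f v).
Proof.
rewrite ffunE sumrB -[LHS]sumrN.
transitivity (\sum_w ((adjacency v w)%:Z * f w - (valency v)%:Z *+ (v == w) * f w)).
  by apply: eq_bigr => w _; rewrite /laplacian -mulNr opprB mulrBl.
rewrite sumrB; congr (_ - _).
  rewrite (partition_big (fun h => root (flip h)) xpredT) //=; apply: eq_bigr => w _.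
  rewrite (eq_bigr (fun=> f w)) => [|h /andP[_ /eqP ->] //].
  rewrite sumr_const -[RHS]mulr_natl natz; congr (Posz _ * _); apply: eq_card => h.
  by rewrite inE.
rewrite (bigD1 v) //= eqxx big1 ?addr0; last first.
  by move=> w /negPf; rewrite eq_sym => ->; rewrite mul0r.
rewrite sumr_const -[RHS]mulr_natl natz; congr (Posz _ * _); apply: eq_card => h.
by rewrite inE.
Qed.

(** Maximum principle: a vertex where f is maximal has only neighbours of the same value. *)
Lemma harmonic_const (f : {ffun vert G -> int}) :
  connected G -> prin_div f = 0 -> forall u v, f u = f v.
Proof.
move=> /andP[_ /forall_inP con] f0 u0.
case: (Order.TotalTheory.arg_maxP f (erefl : xpredT u0)) => m _ fm.
suff H v : f v = f m by move=> v; rewrite !H.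
have /forall_inP/(_ v (in_setT v)) := con m (in_setT m).
move=> /(connect_ind (P := fun v => f v = f m)).
apply=> // {v} _ _ /adjTP[h [_ <- <-]] fh.
have : \sum_(k | root k == root h) (f m - f (root (flip k))) = 0.
  have /ffunP/(_ (root h)) := f0; rewrite prin_divE ffunE => /(congr1 -%R).
  rewrite oppr0 -sumrN => {2}<-.
  by apply: eq_bigr => k _; rewrite opprB fh.
move/psumr_eq0P => /(_ _ h (eqxx _)) H; apply/eqP; rewrite eq_sym -subr_eq0 H // => k _.
by rewrite subr_ge0; apply: fm.
Qed.

End Graph.

(** * The two sheets of the cover *)

Section Cover.
Variables (Gt G : mgraph) (p : free_double_cover Gt G).
Local Notation iota := (sheet_swap p).

Lemma sheet_swapP u : pV p (iota u) = pV p u /\ iota u != u.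
Proof.
rewrite /sheet_swap; case: pickP => [w /andP[/eqP -> ->] //|none] /=.
have := pV_two p (pV p u); rewrite (cardsD1 u) inE eqxx /= => -[] /eqP.
have -> : [set w | pV p w == pV p u]%SET :\ u = set0; last by rewrite cards0.
by apply/setP => w; rewrite !inE andbC none.
Qed.

Lemma pV_swap u : pV p (iota u) = pV p u. Proof. by case: (sheet_swapP u). Qed.
Lemma swap_neq u : iota u != u. Proof. by case: (sheet_swapP u). Qed.

Lemma fibreE u w : pV p w = pV p u -> w = u \/ w = iota u.
Proof.
move=> wu; apply: contrapT => /not_orP[nu ni].
have := pV_two p (pV p u).
have sub : [set w; iota u; u]%SET \subset [set w | pV p w == pV p u]%SET.
  by apply/subsetP => x; rewrite !inE => /orP[/orP[]|] /eqP ->; rewrite ?wu ?pV_swap.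
have := subset_leq_card sub; rewrite pV_two.
rewrite -setUA cardsU1 cards2 swap_neq !inE.
by case: eqP => // _; case: eqP.
Qed.

Lemma swapK : involutive iota.
Proof.
move=> u; have /fibreE[//|e] : pV p (iota (iota u)) = pV p u by rewrite !pV_swap.
by have := swap_neq (iota u); rewrite e eqxx.
Qed.

Lemma pV_surj v : exists u, pV p u == v.
Proof.
have : (0 < #|[set u | pV p u == v]%SET|)%N by rewrite pV_two.
by move=> /card_gt0P[u]; rewrite inE; exists u.
Qed.

(** A set-theoretic section of the cover, which trivialises it over the vertices. *)
Definition base_lift v : vert Gt := xchoose (pV_surj v).

Lemma pV_base_lift v : pV p (base_lift v) = v.
Proof. exact/eqP/(xchooseP (pV_surj v)). Qed.

Definition sheet u : bool := u != base_lift (pV p u).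

Lemma sheet_base_lift v : sheet (base_lift v) = false.
Proof. by rewrite /sheet pV_base_lift eqxx. Qed.

Lemma sheet_swapN u : sheet (iota u) = ~~ sheet u.
Proof.
rewrite /sheet pV_swap negbK; have := pV_base_lift (pV p u) => /fibreE[]->.
  by rewrite eqxx swap_neq.
by rewrite eqxx [u == _]eq_sym; apply/esym; rewrite (negPf (swap_neq u)).
Qed.

Lemma sum_fibre (R : zmodType) (F : vert Gt -> R) v :
  \sum_(u | pV p u == v) F u = F (base_lift v) + F (iota (base_lift v)).
Proof.
rewrite (bigD1 (base_lift v)) ?pV_base_lift //=.
rewrite (bigD1 (iota (base_lift v))) /= ?pV_swap ?pV_base_lift ?swap_neq ?eqxx //.
rewrite big1 ?addr0 // => w /andP[/andP[/eqP wv]].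
by have := fibreE (etrans wv (esym (pV_base_lift v))) => -[] ->; rewrite eqxx.
Qed.

Lemma sum_vert_cover (R : zmodType) (F : vert Gt -> R) :
  \sum_u F u = \sum_v (F (base_lift v) + F (iota (base_lift v))).
Proof.
rewrite (partition_big (pV p) xpredT) //=.
by apply: eq_bigr => v _; exact: sum_fibre.
Qed.

Lemma sum_star (R : zmodType) u (F : hedge G -> R) :
  \sum_(k | root k == u) F (pH p k) = \sum_(h | root h == pV p u) F h.
Proof.
rewrite (partition_big (pH p) (fun h => root h == pV p u)) /=; last first.
  by move=> k /eqP <-; rewrite pH_root.
apply: eq_bigr => h /eqP hu; have [k [[ku kh] kP]] := pH_local hu.
rewrite (big_pred1 k) ?kh // => k'; apply/andP/eqP => [[/eqP k'u /eqP k'h]|-> ].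
  by rewrite (kP k').
by rewrite ku kh.
Qed.

Lemma pH_surj h : exists k, pH p k == h.
Proof.
have [|k [[_ kh] _]] := @pH_local _ _ p (base_lift (root h)) h; first by rewrite pV_base_lift.
by exists k; apply/eqP.
Qed.

Lemma pH_fibre k k' : pH p k' = pH p k ->
  k' = k \/ (root k' = iota (root k) /\ root (flip k') = iota (root (flip k))).
Proof.
move=> e; have [|ne] := eqVneq k' k; [by left | right].
have loc a b : pH p a = pH p b -> b != a -> root a = iota (root b).
  move=> eab nab; have rab : pV p (root a) = pV p (root b) by rewrite -!pH_root eab.
  have [ab|//] := fibreE rab.
  have [c [_ cP]] := @pH_local _ _ p (root b) (pH p b) (pH_root p b).
  by move: nab; rewrite -(cP a) // -(cP b) ?eqxx.
split; first by apply: loc => //; rewrite eq_sym.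
by apply: loc; rewrite ?pH_flip ?e // (inv_eq (@flipK Gt)) flipK eq_sym.
Qed.

(** An edge crosses when its lifts connect the two sheets; both of its lifts then do, so
the choice of a lift is immaterial (crossingE).  This is the voltage of the edge. *)
Definition crossing h : bool :=
  let k := xchoose (pH_surj h) in sheet (root k) (+) sheet (root (flip k)).

Lemma crossingE k : crossing (pH p k) = sheet (root k) (+) sheet (root (flip k)).
Proof.
rewrite /crossing; set k' := xchoose _.
have /eqP/pH_fibre[->//|[-> ->]] : pH p k' == pH p k := xchooseP (pH_surj (pH p k)).
by rewrite !sheet_swapN; case: (sheet _); case: (sheet _).
Qed.

Lemma hedge_lift h : exists2 k, pH p k = h & root k = base_lift (root h).
Proof.
have [|k [[kr kh] _]] := @pH_local _ _ p (base_lift (root h)) h; first by rewrite pV_base_lift.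
by exists k.
Qed.

Lemma crossing_flip h : crossing (flip h) = crossing h.
Proof.
have [k <- _] := hedge_lift h; rewrite -pH_flip !crossingE flipK; exact: addbC.
Qed.

(** The isomorphism from functions on G to anti-invariant functions on the cover, that is,
to divisors of trivial norm. *)
Definition lift (x : {ffun vert G -> int}) : {ffun vert Gt -> int} :=
  [ffun u => (-1) ^+ sheet u * x (pV p u)].

Lemma lift_swap x u : lift x (iota u) = - lift x u.
Proof. by rewrite !ffunE sheet_swapN pV_swap signrN mulNr. Qed.

Lemma lift_base_lift x v : lift x (base_lift v) = x v.
Proof. by rewrite ffunE sheet_base_lift mul1r pV_base_lift. Qed.

Lemma liftB x y : lift (x - y) = lift x - lift y.
Proof. by apply/ffunP => u; rewrite !ffunE mulrBr. Qed.

Lemma NmDivE (D : Div Gt) v : NmDiv p D v = D (base_lift v) + D (iota (base_lift v)).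
Proof. by rewrite ffunE sum_fibre. Qed.

Lemma Nm0_lift (D : Div Gt) : NmDiv p D = 0 -> D = lift [ffun v => D (base_lift v)].
Proof.
move=> D0; have swap v : D (iota (base_lift v)) = - D (base_lift v).
  by have /ffunP/(_ v) := D0; rewrite NmDivE ffunE => /eqP; rewrite addrC addr_eq0 => /eqP.
apply/ffunP => u; have [e|e] := fibreE (esym (pV_base_lift (pV p u))).
  by rewrite e lift_base_lift ffunE.
by rewrite e swap lift_swap lift_base_lift ffunE.
Qed.

Lemma Nm_lift x : NmDiv p (lift x) = 0.
Proof. by apply/ffunP => v; rewrite NmDivE lift_swap subrr ffunE. Qed.

(** * The signed Laplacian and the signed incidence matrix *)

(** The Laplacian of the cover in the coordinates given by lift: crossing edges enter the
adjacency part with a sign. *)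
Definition signed_laplacian (x : {ffun vert G -> int}) : {ffun vert G -> int} :=
  [ffun v => \sum_(h | root h == v) (x v - (-1) ^+ crossing h * x (root (flip h)))].

Lemma lift_edge (x : {ffun vert G -> int}) k :
  x (root (pH p k)) - (-1) ^+ crossing (pH p k) * x (root (flip (pH p k))) =
  (-1) ^+ sheet (root k) * (lift x (root k) - lift x (root (flip k))).
Proof.
by rewrite crossingE -pH_flip !pH_root !ffunE mulrBr !mulrA -!signr_addb addbb mul1r.
Qed.

Lemma prin_div_lift x : prin_div (lift x) = - lift (signed_laplacian x).
Proof.
apply/ffunP => u; rewrite prin_divE [RHS]ffunE [lift (signed_laplacian x) u]ffunE.
rewrite [signed_laplacian _ _]ffunE.
rewrite -(sum_star u (fun h => x (pV p u) - (-1) ^+ crossing h * x (root (flip h)))).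
rewrite mulr_sumr -sumrN.
apply: eq_bigr => k /eqP ku.
have := lift_edge x k; rewrite pH_root ku => ->.
by rewrite mulrA -signr_addb addbb mul1r opprB.
Qed.

(** The column of e is the boundary of e in the coordinates given by lift, for the
orientation that pick selects; columns of non-edges vanish.  A crossing loop has the
entry 2, an ordinary loop 0. *)
Definition incidence (v : vert G) (e : {set hedge G}) : int :=
  if [pick h | edge_of h == e] is Some h
  then (root h == v)%:R - (-1) ^+ crossing h * (root (flip h) == v)%:R else 0.

Lemma sum_delta (T : finType) (R : pzRingType) (a : T) (x : T -> R) :
  \sum_w (a == w)%:R * x w = x a.
Proof.
rewrite (bigD1 a) //= eqxx mul1r big1 ?addr0 // => w.
by rewrite eq_sym => /negPf ->; rewrite mul0r.
Qed.

Lemma incidence_dot (x : vert G -> int) e : \sum_w incidence w e * x w =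
  if [pick h | edge_of h == e] is Some h
  then x (root h) - (-1) ^+ crossing h * x (root (flip h)) else 0.
Proof.
rewrite /incidence; case: pickP => [h _|_]; last by rewrite big1 // => w _; rewrite mul0r.
rewrite -(sum_delta (root h) x) -(sum_delta (root (flip h)) x) mulr_sumr -sumrB.
by apply: eq_bigr => w _; rewrite mulrBl mulrA.
Qed.

(** The factorisation N N^T of the signed Laplacian: an edge contributes the terms of its
two half-edges to the sums over stars. *)
Lemma signed_laplacianE (x : {ffun vert G -> int}) v :
  signed_laplacian x v = \sum_w (\sum_e incidence v e * incidence w e) * x w.
Proof.
transitivity (\sum_e incidence v e * \sum_w incidence w e * x w); last first.
  rewrite (eq_bigr (fun e => \sum_w incidence v e * (incidence w e * x w))); last first.
    by move=> e _; rewrite mulr_sumr.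
  rewrite exchange_big /=; apply: eq_bigr => w _; rewrite mulr_suml.
  by apply: eq_bigr => e _; rewrite mulrA.
rewrite ffunE big_mkcond sum_hedges; apply: eq_bigr => e _.
rewrite incidence_dot /incidence; case: pickP => [h _|_]; last by rewrite mul0r.
rewrite flipK crossing_flip.
case: (root h =P v) => [->|_]; case: (root (flip h) =P v) => [->|_];
  rewrite ?mulr1 ?mulr0 ?subr0 ?mul1r ?mul0r ?addr0 ?add0r ?sub0r //;
  case: (crossing h); rewrite /= ?expr0 ?expr1; lia.
Qed.

End Cover.

(** * Components and their preimages *)

Section Comp.
Variables (G : mgraph) (B : {set {set hedge G}}).
Local Notation c := (connect (adj setT B)).

Lemma connect_equiv : {in [set: vert G] & &, equivalence_rel c}.
Proof.
move=> u v w _ _ _; split=> [|uv]; first exact: connect0.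
exact: (same_connect (adj_connect_sym _ _) uv).
Qed.

Lemma components_partition : partition (components B) setT.
Proof. exact: equivalence_partitionP connect_equiv. Qed.

Lemma mem_component u v : (v \in pblock (components B) u) = c u v.
Proof. by rewrite (pblock_equivalence_partition connect_equiv) ?inE. Qed.

Lemma componentP U : U \in components B -> exists u, U = pblock (components B) u.
Proof.
have /and3P[_ triv n0] := components_partition => UP.
have /set0Pn[u uU] : U != set0 by apply: contraNneq n0 => <-.
by exists u; rewrite (def_pblock triv UP uU).
Qed.

Lemma pblock_component u : pblock (components B) u \in components B.
Proof.
by apply: pblock_mem; have /and3P[/eqP -> _ _] := components_partition; rewrite inE.
Qed.

Lemma component_closed U u v : U \in components B -> c u v -> (u \in U) = (v \in U).
Proof.
move=> /componentP[w ->] uv; rewrite !mem_component.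
exact: (same_connect_r (adj_connect_sym _ _) uv).
Qed.

End Comp.

Section Cover.
Variables (Gt G : mgraph) (p : free_double_cover Gt G).
Local Notation iota := (sheet_swap p).

(** No component of the subgraph B of G lifts to two disjoint copies of itself; see
twistedE. *)
Definition twisted (B : {set {set hedge G}}) : bool :=
  [forall u, connect (adj setT (preim_edges p B)) u (iota u)].

Section Sub.
Variable B : {set {set hedge G}}.
Local Notation c := (connect (adj setT B)).
Local Notation ct := (connect (adj setT (preim_edges p B))).

Lemma imset_edge_of k : (pH p @: edge_of k)%SET = edge_of (pH p k).
Proof. by rewrite /edge_of imsetU1 imset_set1 pH_flip. Qed.

Lemma preim_edgeE k : (edge_of k \in preim_edges p B) = (edge_of (pH p k) \in B).
Proof. by rewrite inE edge_of_edges imset_edge_of. Qed.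

Lemma swap_connect u w : ct u w -> ct (iota u) (iota w).
Proof.
move=> uw; apply: (connect_ind (P := fun w => ct (iota u) (iota w)) _ uw); last first.
  exact: connect0.
move=> {uw w} a b /adjTP[k [kB <- <-]] ua; apply: connect_trans ua _.
have [k' kk' rk'] : exists2 k', pH p k' = pH p k & root k' = iota (root k).
  have [|k' [[ku kh] _]] := @pH_local _ _ p (iota (root k)) (pH p k).
    by rewrite pV_swap pH_root.
  by exists k'.
have [ek|[_ fk']] := pH_fibre kk'.
  by have := swap_neq p (root k); rewrite -rk' ek eqxx.
by rewrite -rk' -fk'; apply/connect1/adjT_edge; rewrite preim_edgeE kk' -preim_edgeE.
Qed.

(** The path is lifted edge by edge, by the local isomorphism property at each vertex. *)
Lemma path_lift u v : c (pV p u) v -> exists2 w, pV p w = v & ct u w.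
Proof.
move=> uv; apply: (connect_ind (P := fun v => exists2 w, pV p w = v & ct u w) _ uv).
  2: by exists u.
move=> {uv v} a b /adjTP[h [hB ha hb]] [w wa uw].
have [|k [[kr kh] _]] := @pH_local _ _ p w h; first by rewrite wa.
exists (root (flip k)); first by rewrite -pH_root pH_flip kh.
by apply: connect_trans uw _; rewrite -kr; apply/connect1/adjT_edge; rewrite preim_edgeE kh.
Qed.

(** A lift of a path from pV u to pV w ends at w or at the other point of its fibre; in
the second case twistedness provides the remaining connection. *)
Lemma connect_over u w : twisted B -> c (pV p u) (pV p w) -> ct u w.
Proof.
move=> /forallP tw /path_lift[w' ww' uw'].
have [<- //|e] := fibreE ww'.
by rewrite e in uw'; apply: connect_trans uw' _; have := tw (iota w); rewrite swapK.
Qed.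

(** A walk in the preimage of B never leaves the preimage of a component. *)
Lemma preim_connected_component U : U \in components B ->
  preim_connected p U (edges_in B U) =
  [forall u in pV p @^-1: U, forall w in pV p @^-1: U, ct u w].
Proof.
move=> UB; rewrite /preim_connected /sub_connected.
have -> : (pV p @^-1: U)%SET != set0.
  have [u ->] := componentP UB; apply/set0Pn; exists (base_lift p u).
  by rewrite !inE pV_base_lift mem_component connect0.
have H u w : u \in (pV p @^-1: U)%SET ->
    connect (adj (pV p @^-1: U)%SET (preim_edges p (edges_in B U))) u w = ct u w.
  move=> uU; apply/idP/idP.
    apply: connect_sub => a b.
    rewrite /adj => /and3P[_ _ /existsP[k /and3P[kB /eqP <- /eqP <-]]].
    apply/connect1/adjT_edge; move: kB; rewrite !inE; case/andP => -> /=.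
    by case/andP.
  pose P w := connect (adj (pV p @^-1: U)%SET (preim_edges p (edges_in B U))) u w /\
    w \in (pV p @^-1: U)%SET.
  move=> uw; suff [] : P w by [].
  apply: (connect_ind (P := P) _ uw); last by split.
  move=> {uw w} a b /adjTP[k [kB <- <-]] [ua aU].
  have kB' : edge_of (pH p k) \in B by rewrite -preim_edgeE.
  have bU : root (flip k) \in (pV p @^-1: U)%SET.
    rewrite inE -pH_root pH_flip -(component_closed UB (connect1 (adjT_edge kB'))).
    by move: aU; rewrite inE pH_root.
  split=> //; apply: connect_trans ua _; apply: connect1; rewrite /adj aU bU /=.
  apply/existsP; exists k; rewrite !eqxx !andbT.
  rewrite inE edge_of_edges imset_edge_of inE kB'.
  apply/forall_inP => h; rewrite !inE => /orP[] /eqP ->.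
    by move: aU; rewrite inE pH_root.
  by move: bU; rewrite inE -pH_flip pH_root.
by apply: eq_forallb_in => u uU; apply: eq_forallb_in => w wU; rewrite H.
Qed.

Lemma twistedE : twisted B = [forall U in components B, preim_connected p U (edges_in B U)].
Proof.
apply/idP/forall_inP => [tw U UB|H].
  rewrite preim_connected_component //; apply/forall_inP => u uU; apply/forall_inP => w wU.
  apply: connect_over => //; move: uU wU; have [v ->] := componentP UB.
  rewrite !inE !mem_component => vu vw; apply: connect_trans vw; by rewrite adj_connect_sym.
apply/forallP => u; have := H _ (pblock_component B (pV p u)).
have uU w : pV p w = pV p u -> w \in (pV p @^-1: pblock (components B) (pV p u))%SET.
  by move=> wu; rewrite inE mem_component wu connect0.
rewrite preim_connected_component ?pblock_component //.
by move=> /forall_inP/(_ u (uU _ erefl))/forall_inP/(_ _ (uU _ (pV_swap p u))).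
Qed.

End Sub.

(** * Maximal minors of the signed incidence matrix *)

(** The sign b accounts for the orientation selected by pick. *)
Lemma incidence_dot_edge h : exists b : bool, forall x : vert G -> int,
  \sum_w incidence p w (edge_of h) * x w =
  (-1) ^+ b * (x (root h) - (-1) ^+ crossing p h * x (root (flip h))).
Proof.
case E : [pick h' | edge_of h' == edge_of h] => [h'|]; last first.
  by move: E; case: pickP => // /(_ h); rewrite eqxx.
have hh' : edge_of h' = edge_of h by move: E; case: pickP => // k /eqP kh [<-].
have [e|e] := edge_ofP (esym hh'); [exists false | exists (~~ crossing p h)] => x;
  rewrite incidence_dot E e.
  by rewrite mul1r.
rewrite flipK crossing_flip; case: (crossing p h) => /=; lia.
Qed.

Variable f : {ffun 'I_#|vert G| -> {set hedge G}}.
Let B := [set f i | i : 'I_#|vert G|]%SET.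
Local Notation ct := (connect (adj setT (preim_edges p B))).

Lemma row_mul_col_submx (x : vert G -> int) j :
  ((\row_i x (enum_val i)) *m col_submx f (incidence p)) 0 j =
  \sum_w incidence p w (f j) * x w.
Proof.
rewrite mxE (reindex enum_rank) /=; last by apply: onW_bij; exact: enum_rank_bij.
by apply: eq_bigr => w _; rewrite !mxE enum_rankK mulrC.
Qed.

Lemma det_incidence_nonedge : ~~ (B \subset edges G) -> \det (col_submx f (incidence p)) = 0.
Proof.
move=> /subsetPn[_ /imsetP[j _ ->]] fj.
rewrite (expand_det_col _ j) big1 // => i _; rewrite mxE /incidence.
case: pickP => [h /eqP hj|]; last by rewrite mul0r.
by move: fj; rewrite -hj edge_of_edges.
Qed.

Lemma det_incidence_kernel (x : vert G -> int) :
  (forall h, edge_of h \in B -> x (root h) = (-1) ^+ crossing p h * x (root (flip h))) ->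
  (exists v, x v != 0) -> \det (col_submx f (incidence p)) = 0.
Proof.
move=> xB [v xv]; apply/eqP/det0P; exists (\row_i x (enum_val i)).
  apply: contraNneq xv => /matrixP/(_ 0 (enum_rank v)).
  by rewrite !mxE enum_rankK => ->; exact: eqxx.
apply/matrixP => i j; rewrite ord1 row_mul_col_submx mxE incidence_dot.
case: pickP => // h /eqP hj; rewrite (xB h) ?subrr // hj; exact: imset_f.
Qed.

(** If u is not connected to iota u, the components of u and of iota u in the preimage of
B are disjoint, and the difference of their indicators is anti-invariant and constant
along edges: it is a nonzero row vector killed by the matrix. *)
Lemma det_incidence_untwisted : ~~ twisted B -> \det (col_submx f (incidence p)) = 0.
Proof.
move=> /forallPn[u nu].
pose x : {ffun vert G -> int} :=
  [ffun v => (ct u (base_lift p v))%:R - (ct u (iota (base_lift p v)))%:R].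
have lx w : lift p x w = (ct u w)%:R - (ct u (iota w))%:R.
  have [e|e] := fibreE (esym (pV_base_lift p (pV p w))); rewrite e.
    by rewrite lift_base_lift ffunE.
  by rewrite lift_swap lift_base_lift ffunE opprB swapK.
apply: (@det_incidence_kernel x).
  move=> h; have [k <- _] := hedge_lift p h => kB; apply/eqP; rewrite -subr_eq0 lift_edge !lx.
  have kk : ct (root k) (root (flip k)) by apply/connect1/adjT_edge; rewrite preim_edgeE.
  rewrite (same_connect_r (adj_connect_sym _ _) kk).
  by rewrite (same_connect_r (adj_connect_sym _ _) (swap_connect kk)) subrr mulr0.
exists (pV p u); have := lx u; rewrite ffunE connect0 (negPf nu) subr0 => e.
by apply/eqP => x0; move: e; rewrite x0 mulr0.
Qed.

(** A row vector killed by the matrix lifts to a function constant on the components of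
the preimage, hence both invariant and anti-invariant, hence zero. *)
Lemma det_incidence_neq0 : twisted B -> \det (col_submx f (incidence p)) != 0.
Proof.
move=> tw; apply/det0P => -[y y0 yN].
pose x : {ffun vert G -> int} := [ffun v => y 0 (enum_rank v)].
have yE : y = \row_i x (enum_val i) by apply/matrixP => i j; rewrite ord1 !mxE ffunE enum_valK.
have xB k : edge_of (pH p k) \in B -> lift p x (root k) = lift p x (root (flip k)).
  move=> kB; have [b bP] := incidence_dot_edge (pH p k).
  move: kB => /imsetP[j _ kj].
  have := row_mul_col_submx x j; rewrite -yE yN mxE -kj bP lift_edge => /esym/eqP.
  by rewrite !mulf_eq0 !signr_eq0 /= subr_eq0 => /eqP.
have lc u w : ct u w -> lift p x w = lift p x u.
  move=> uw; apply: (connect_ind (P := fun w => lift p x w = lift p x u) _ uw) => // a b.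
  by move=> /adjTP[k [kB <- <-]] <-; rewrite (xB k) // -preim_edgeE.
case/eqP: y0; rewrite yE; apply/matrixP => i j; rewrite !mxE; set v := enum_val j.
have /forallP/(_ (base_lift p v))/lc := tw; rewrite lift_swap lift_base_lift; lia.
Qed.

End Cover.

Lemma sum_ffunB (T : finType) (P : pred T) (x y : {ffun T -> int}) :
  \sum_(v | P v) (x - y) v = \sum_(v | P v) x v - \sum_(v | P v) y v.
Proof. by rewrite -sumrB; apply: eq_bigr => v _; rewrite !ffunE. Qed.

Lemma dvd2B (a b : int) : (2 %| a - b)%Z = ((2 %| a)%Z == (2 %| b)%Z).
Proof. by lia. Qed.

Section Cover.
Variables (Gt G : mgraph) (p : free_double_cover Gt G).
Local Notation iota := (sheet_swap p).

Section TwistedMinor.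
Variable f : {ffun 'I_#|vert G| -> {set hedge G}}.
Let B := [set f i | i : 'I_#|vert G|]%SET.
Local Notation ct := (connect (adj setT (preim_edges p B))).
Local Notation c := (connect (adj setT B)).
Hypothesis BE : B \subset edges G.
Hypothesis tw : twisted p B.

Definition in_image (x : {ffun vert G -> int}) : Prop :=
  exists z : 'I_#|vert G| -> int, forall v, x v = \sum_j incidence p v (f j) * z j.

Lemma in_image0 : in_image 0.
Proof. by exists (fun=> 0) => v; rewrite ffunE big1 // => j _; rewrite mulr0. Qed.

Lemma in_imageB x y : in_image x -> in_image y -> in_image (x - y).
Proof.
move=> [a xa] [b yb]; exists (fun j => a j - b j) => v; rewrite !ffunE xa yb -sumrB.
by apply: eq_bigr => j _; rewrite mulrBr.
Qed.

Lemma in_imageN x : in_image x -> in_image (- x).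
Proof. by move=> xI; rewrite -sub0r; apply: in_imageB => //; exact: in_image0. Qed.

Lemma in_imageD x y : in_image x -> in_image y -> in_image (x + y).
Proof. by move=> xI yI; rewrite -[y]opprK; apply: in_imageB => //; apply: in_imageN. Qed.

Lemma ffun_mulrzE (x : {ffun vert G -> int}) a v : (x *~ a) v = a * x v.
Proof. by rewrite ffunMzE mulrzz mulrC. Qed.

Lemma in_imageZ (a : int) x : in_image x -> in_image (x *~ a).
Proof.
move=> [b xb]; exists (fun j => a * b j) => v; rewrite ffun_mulrzE xb mulr_sumr.
by apply: eq_bigr => j _; rewrite mulrCA.
Qed.

Lemma in_image_sum (I : finType) (P : pred I) (F : I -> {ffun vert G -> int}) :
  (forall i, P i -> in_image (F i)) -> in_image (\sum_(i | P i) F i).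
Proof.
move=> FI; elim/big_rec: _ => [|i x Pi xI]; first exact: in_image0.
by apply: in_imageD => //; exact: FI.
Qed.

(** The image of u in the quotient of the divisor group of the cover by the relations
iota u = - u; the vertices of G give a basis of this quotient. *)
Definition sdelta (u : vert Gt) : {ffun vert G -> int} :=
  [ffun v => (-1) ^+ sheet p u * (pV p u == v)%:R].

Lemma sdelta_swap u : sdelta (iota u) = - sdelta u.
Proof. by apply/ffunP => v; rewrite !ffunE sheet_swapN pV_swap signrN mulNr. Qed.

Lemma in_image_connect u w : ct u w -> in_image (sdelta u - sdelta w).
Proof.
move=> uw; apply: (connect_ind (P := fun w => in_image (sdelta u - sdelta w)) _ uw);
  last first.
  by rewrite subrr; exact: in_image0.
move=> {uw w} _ _ /adjTP[k [kB <- <-]] uI.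
rewrite -(subrKA (sdelta (root k))); apply: in_imageD => //.
move: kB; rewrite preim_edgeE => /imsetP[j _ kj].
have [b bP] := incidence_dot_edge p (pH p k).
exists (fun i => (-1) ^+ (b (+) sheet p (root k)) * (i == j)%:R) => v.
rewrite (bigD1 j) //= eqxx big1 ?addr0 ?mulr1; last first.
  by move=> i /negPf ->; rewrite !mulr0.
have := bP (fun w => (v == w)%:R).
rewrite (eq_bigr (fun w => (v == w)%:R * incidence p w (f j))).
  rewrite sum_delta => ->; rewrite !ffunE crossingE !pH_root -pH_flip !pH_root ![v == _]eq_sym.
  by case: b {bP}; case: (sheet p (root k)); case: (sheet p (root (flip k))) => /=; lia.
by move=> w _; rewrite mulrC kj.
Qed.

(** u and iota u are connected and have opposite images. *)
Lemma in_image_double v : in_image (sdelta (base_lift p v) *~ 2).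
Proof.
have /forallP/(_ (base_lift p v))/in_image_connect := tw.
by rewrite sdelta_swap opprK -mulr2n.
Qed.

Lemma in_image_component v w :
  c v w -> in_image (sdelta (base_lift p v) - sdelta (base_lift p w)).
Proof.
move=> vw; apply: in_image_connect; apply: connect_over tw _.
by rewrite !pV_base_lift.
Qed.

Lemma sdelta_decomp (x : {ffun vert G -> int}) : x = \sum_v sdelta (base_lift p v) *~ x v.
Proof.
apply/ffunP => v; rewrite sum_ffunE (bigD1 v) //= big1 ?addr0.
  by rewrite ffun_mulrzE ffunE sheet_base_lift pV_base_lift eqxx expr0 !mulr1.
by move=> w /negPf wv; rewrite ffun_mulrzE ffunE pV_base_lift wv !mulr0.
Qed.

(** Modulo the image, vertices of one component agree and have order two, so only the
parity of the sum over the component matters. *)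
Lemma even_components_image (x : {ffun vert G -> int}) :
  (forall U, U \in components B -> (2 %| \sum_(v in U) x v)%Z) -> in_image x.
Proof.
move=> ev; pose r := fingraph.root (adj setT B).
have rP v : c v (r v) by exact: connect_root.
(* Move all the weight of a component to its root r v. *)
have -> : x = \sum_v (sdelta (base_lift p v) - sdelta (base_lift p (r v))) *~ x v +
              \sum_v sdelta (base_lift p (r v)) *~ x v.
  rewrite -big_split /= [LHS]sdelta_decomp; apply: eq_bigr => v _.
  by rewrite mulrzBl subrK.
apply: in_imageD.
  by apply: in_image_sum => v _; apply: in_imageZ; apply: in_image_component.
rewrite (partition_big r xpredT) //=; apply: in_image_sum => w _.
rewrite (eq_bigr (fun v => sdelta (base_lift p w) *~ x v)) => [|v /eqP -> //].
rewrite -mulrz_sumr.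
have [rw|rw] := eqVneq (r w) w; last first.
  rewrite big_pred0 ?mulr0z; first exact: in_image0.
  move=> v; apply: contraNF rw => /eqP <-; apply/eqP.
  by apply/esym/(fingraph.rootP (adj_connect_sym _ _)).
have /dvdzP[q qE] := ev _ (pblock_component B w).
have -> : \sum_(v | r v == w) x v = q * 2.
  rewrite -qE; apply: eq_bigl => v.
  rewrite mem_component -(fingraph.root_connect (adj_connect_sym _ _)) -/(r w) -/(r v) rw.
  exact: eq_sym.
by rewrite mulrC mulrzA; apply: in_imageZ; apply: in_image_double.
Qed.

Lemma image_even_components (x : {ffun vert G -> int}) U :
  in_image x -> U \in components B -> (2 %| \sum_(v in U) x v)%Z.
Proof.
move=> [z xz] UB; rewrite (eq_bigr _ (fun v _ => xz v)) exchange_big /=.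
apply: rpred_sum => j _; rewrite -mulr_suml; apply: dvdz_mulr.
have jB : f j \in B by exact: imset_f.
have /subsetP/(_ _ jB)/imsetP[h _ jh] := BE.
have [b bP] := incidence_dot_edge p h.
have := bP (fun w => (w \in U)%:R); rewrite jh.
rewrite (eq_bigr (fun w => if w \in U then incidence p w (edge_of h) else 0)); last first.
  by move=> w _; case: (w \in U); rewrite ?mulr1 ?mulr0.
rewrite -big_mkcond /= => ->.
rewrite -(component_closed UB (connect1 (adjT_edge (_ : edge_of h \in B)))) -?jh //.
by apply: dvdz_mull; case: (crossing p h); case: (_ \in U).
Qed.

Lemma index_image : has_index in_image (2 ^ #|components B|).
Proof.
rewrite -card_powerset.
(* phi x is the set of components on which x has an odd sum. *)
pose phi (x : {ffun vert G -> int}) :=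
  [set U in components B | ~~ (2 %| \sum_(v in U) x v)%Z]%SET.
apply: (has_index_set (phi := phi)).
- by move=> x; rewrite powersetE; apply/subsetP => U; rewrite inE => /andP[].
- move=> S; rewrite powersetE => /subsetP SP.
  pose r := fingraph.root (adj setT B).
  exists [ffun v => ((r v == v) && (pblock (components B) v \in S))%:R].
  apply/setP => U; rewrite inE; case UP: (U \in components B); last first.
    by apply/esym/negP => /SP; rewrite UP.
  have [u Uu] := componentP UP.
  have cs := adj_connect_sym [set: vert G] B.
  rewrite (bigD1 (r u)) /=; last by rewrite Uu mem_component connect_root.
  rewrite big1 ?addr0.
    rewrite ffunE {1}/r root_root // eqxx /=.
    have -> : pblock (components B) (r u) = U.
      rewrite Uu; have /and3P[_ triv _] := components_partition B.
      by apply: def_pblock; rewrite ?pblock_component // mem_component connect_root.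
    by case: (U \in S).
  move=> v /andP[]; rewrite Uu mem_component ffunE => uv; case: (r v =P v) => //= rv.
  by have /(fingraph.rootP cs) := uv; rewrite -/(r u) -/(r v) rv => ->; rewrite eqxx.
move=> x y; split=> [e|xyI].
  apply: even_components_image => U UP; have /setP/(_ U) := e; rewrite !inE UP /=.
  by rewrite sum_ffunB dvd2B => /(congr1 negb); rewrite !negbK => ->.
apply/setP => U; rewrite !inE; case UP: (U \in components B) => //=.
have := image_even_components xyI UP.
by rewrite sum_ffunB dvd2B => /eqP ->.
Qed.

(** Both sides are the index of the lattice spanned by the columns. *)
Lemma det_incidence_twisted : `|\det (col_submx f (incidence p))|%N = (2 ^ #|components B|)%N.
Proof. exact: has_index_inj (index_col_submx (det_incidence_neq0 tw)) index_image. Qed.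

(** A nonzero determinant has a nonzero term in its Leibniz expansion. *)
Lemma twisted_matching : injective f -> exists m : vert G -> {set hedge G},
  [/\ injective m, forall v, m v \in B & forall v, exists2 h, m v = edge_of h & root h = v].
Proof.
move=> fi; have N0 := det_incidence_neq0 tw.
have [s sN] : exists s : 'S_#|vert G|, forall i, col_submx f (incidence p) i (s i) != 0.
  apply: contrapT => none; move/negP: N0; apply; rewrite /determinant big1 // => s _.
  apply/eqP; rewrite mulf_eq0 signr_eq0 /=; apply/negPn/negP => /prodf_neq0 H.
  by apply: none; exists s => i; apply: H.
exists (fun v => f (s (enum_rank v))); split.
- by move=> v w /fi/perm_inj/enum_rank_inj.
- by move=> v; exact: imset_f.
move=> v; have := sN (enum_rank v); rewrite mxE enum_rankK /incidence.
case: pickP => [h /eqP hE|]; last by rewrite eqxx.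
have [hv _|_] := root h =P v; first by exists h.
have [hv _|_] := root (flip h) =P v; first by exists (flip h); rewrite ?edge_of_flip.
by rewrite mulr0 subr0 eqxx.
Qed.

End TwistedMinor.
End Cover.

(** * Odd genus one decompositions *)

(** A set S of components is determined by whether it contains the component of v0
together with the edges of F that leave the union of S: traversing any other edge of the
connected graph G does not change membership.  Counting such S gives 2^c <= 2^(|F| + 1)
for c components. *)
Lemma card_components (G : mgraph) (F : {set {set hedge G}}) :
  connected G -> (#|components (edges G :\: F)| <= #|F|.+1)%N.
Proof.
move=> con; set A := edges G :\: F; set C := components A.
have /set0Pn[v0 _] : [set: vert G]%SET != set0 by case/andP: con.
pose D (S : {set {set vert G}}) u := pblock C u \in S.
pose split S e := [exists h, (edge_of h == e) && (D S (root h) != D S (root (flip h)))].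
have splitE S h : split S (edge_of h) = (D S (root h) != D S (root (flip h))).
  apply/existsP/idP => [[h' /andP[/eqP hh']]|]; last by exists h; rewrite eqxx.
  by have [->|->] := edge_ofP hh'; rewrite // flipK eq_sym.
pose code S := (D S v0, [set e in F | split S e]).
have codeP : {in powerset C &, injective code}.
  move=> S S'; rewrite !powersetE => /subsetP SC /subsetP S'C [e0 eF].
  have H u : D S u = D S' u.
    have /andP[_ /forall_inP/(_ v0 (in_setT _))/forall_inP/(_ u (in_setT _)) v0u] := con.
    apply: (connect_ind (P := fun u => D S u = D S' u) _ v0u) => //.
    move=> {v0u} _ _ /adjTP[h [hE <- <-]] eh.
    case hF: (edge_of h \in F).
      have /setP/(_ (edge_of h)) := eF; rewrite !inE hF /= !splitE eh.
      by case: (D S _); case: (D S' _); case: (D S' _).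
    have same : pblock C (root h) = pblock C (root (flip h)).
      apply: same_pblock; first by have /and3P[] := components_partition A.
      rewrite mem_component -(adj_connect_sym _ _); apply/connect1/adjT_edge.
      by rewrite !inE hF edge_of_edges.
    by rewrite /D -same.
  apply/setP => U; apply/idP/idP => US.
    by have /componentP[u Uu] := SC _ US; have := H u; rewrite /D -Uu US => <-.
  by have /componentP[u Uu] := S'C _ US; have := H u; rewrite /D -Uu US => ->.
rewrite -(leq_exp2l _ _ (ltnSn 1)) -card_powerset -(card_in_imset codeP).
have -> : (2 ^ #|F|.+1 = #|finset.setX [set: bool] (powerset F)|)%N.
  by rewrite cardsX cardsT card_bool card_powerset expnS.
apply: subset_leq_card; apply/subsetP => _ /imsetP[S _ ->].
by rewrite !inE; apply/subsetP => e; rewrite inE => /andP[].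
Qed.

Section Cover.
Variables (Gt G : mgraph) (p : free_double_cover Gt G).

(** The complement of an odd genus one decomposition; that every component has genus one
follows from odd_unicyclic_sizes. *)
Definition odd_unicyclic (B : {set {set hedge G}}) : bool :=
  [&& B \subset edges G, #|B| == #|vert G| & twisted p B].

(** Zaslavsky's matrix-tree theorem for signed graphs: the minors are 0 or, for r
components, 2^r up to sign. *)
Lemma det_signed_laplacian :
  \det (\matrix_(i < #|vert G|, j < #|vert G|)
    \sum_e incidence p (enum_val i) e * incidence p (enum_val j) e) =
  (\sum_(B | odd_unicyclic B) 4 ^ #|components B|)%N%:Z.
Proof.
rewrite (@det_gram _ _ _ (fun B : {set {set hedge G}} =>
  if (B \subset edges G) && twisted p B then (4 ^ #|components B|)%N%:Z else 0)).
  rewrite -big_mkcondr /= (big_morph Posz PoszD (erefl _)); apply: eq_bigl => B.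
  by rewrite /odd_unicyclic andbCA.
move=> f _; case: ifPn => [/andP[BE tw]|]; last first.
  rewrite negb_and => /orP[BE|ntw]; first by rewrite det_incidence_nonedge.
  by rewrite det_incidence_untwisted.
rewrite -[_ ^+ 2]gez0_abs ?sqr_ge0 // abszX det_incidence_twisted //.
by rewrite expnAC.
Qed.

Lemma enum_edges (B : {set {set hedge G}}) : #|B| = #|vert G| ->
  exists2 f : {ffun 'I_#|vert G| -> {set hedge G}},
    injective f & [set f i | i : 'I_#|vert G|] = B.
Proof.
move=> BV; exists [ffun i => enum_val (cast_ord (esym BV) i)].
  by move=> i j; rewrite !ffunE => /enum_val_inj/cast_ord_inj.
apply/setP => e; apply/imsetP/idP => [[i _ ->]|eB]; first by rewrite ffunE enum_valP.
by exists (cast_ord BV (enum_rank_in eB e)) => //; rewrite ffunE cast_ordK enum_rankK_in.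
Qed.

(** The matching of twisted_matching sends the vertices of a component to distinct
edges of the same component, so each component has at least as many edges as vertices; as
the totals agree, all these inequalities are equalities. *)
Lemma odd_unicyclic_sizes B U : odd_unicyclic B -> U \in components B ->
  #|edges_in B U| = #|U|.
Proof.
move=> /and3P[BE /eqP BV tw].
have le W : W \in components B -> (#|W| <= #|edges_in B W|)%N.
  move=> WB; have [f fi fB] := enum_edges BV.
  rewrite -fB in tw; have [m [mi mB mh]] := twisted_matching tw fi; rewrite fB in mB.
  rewrite -(card_imset _ mi); apply: subset_leq_card; apply/subsetP => _ /imsetP[v vW ->].
  have [h hm hv] := mh v; have hB : edge_of h \in B by rewrite -hm.
  rewrite hm inE hB; apply/forall_inP => k; rewrite !inE => /orP[] /eqP ->.
    by rewrite hv.
  by rewrite -(component_closed WB (connect1 (adjT_edge hB))) hv.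
have tot : (\sum_(W in components B) #|edges_in B W| <= \sum_(W in components B) #|W|)%N.
  rewrite -(card_partition (components_partition B)) cardsT -BV -[leqRHS]sum1_card.
  rewrite (eq_bigr (fun W : {set vert G} => \sum_(e in B) (e \in edges_in B W))%N); last first.
    move=> W _; rewrite -sum1_card big_mkcond [RHS]big_mkcond; apply: eq_bigr => e _.
    by rewrite inE; case: (e \in B) => //=; case: [forall _ in _, _].
  rewrite exchange_big /=; apply: leq_sum => e eB.
  have /subsetP/(_ _ eB)/imsetP[h _ eh] := BE.
  rewrite (bigD1 (pblock (components B) (root h))) ?pblock_component //=.
  rewrite big1 ?addn0 ?leq_b1 // => W /andP[WB]; rewrite inE eB /=.
  apply: contraNeq; rewrite eqb0 negbK => /forall_inP/(_ h).
  rewrite eh {1}/edge_of !inE eqxx => /(_ isT) hW; apply/eqP/esym.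
  by apply: def_pblock WB hW; have /and3P[] := components_partition B.
move=> UB; apply/eqP; rewrite eqn_leq le // andbT; move: tot.
rewrite (bigD1 U) //= [leqRHS](bigD1 U) //= => tot.
have : (\sum_(W in components B | W != U) #|W| <=
        \sum_(W in components B | W != U) #|edges_in B W|)%N.
  by apply: leq_sum => W /andP[/le].
by move=> ge; move: (leq_trans tot (leq_add (leqnn #|U|) ge)); rewrite leq_add2r.
Qed.

Lemma odd_genus_one_decompE r F :
  odd_genus_one_decomp p r F =
  [&& F \subset edges G, odd_unicyclic (edges G :\: F) & #|components (edges G :\: F)| == r].
Proof.
rewrite /odd_genus_one_decomp; case FE: (F \subset edges G) => //=.
set B := edges G :\: F.
have EB : (#|edges G| = #|F| + #|B|)%N by rewrite -(cardsID F (edges G)) (setIidPr FE).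
have BE : B \subset edges G by exact: subsetDl.
have gE : (#|F|.+1 == genus G)%N = (#|B| == #|vert G|).
  by rewrite /genus /sub_genus cardsT EB; apply/eqP/eqP; lia.
rewrite gE {1}/odd_unicyclic BE /=; case BV: (#|B| == #|vert G|) => //=.
rewrite andbC; congr (_ && _); rewrite twistedE.
apply/forall_inP/forall_inP => H U UB; first by have /andP[] := H U UB.
rewrite (H U UB) andbT /sub_genus odd_unicyclic_sizes ?subSnn //.
by rewrite /odd_unicyclic BE BV twistedE; apply/forall_inP.
Qed.

(** The bound on r loses nothing, by card_components. *)
Lemma sum_odd_genus_one_decomp : connected G ->
  (4 * \sum_(1 <= r < (genus G).+1) 4 ^ (r - 1) * num_odd_genus_one_decomp p r)%N =
  (\sum_(B | odd_unicyclic B) 4 ^ #|components B|)%N.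
Proof.
move=> con; rewrite big_distrr /=.
transitivity (\sum_(1 <= r < (genus G).+1)
    \sum_(B | odd_unicyclic B && (#|components B| == r)) 4 ^ r)%N.
  apply: eq_big_nat => r /andP[r1 _].
  rewrite mulnA -expnS subn1 prednK // sum_nat_const mulnC; congr (_ * _)%N.
  have inj : {in [set F | odd_genus_one_decomp p r F] &, injective (fun F => edges G :\: F)}.
    move=> F F'; rewrite !inE !odd_genus_one_decompE => /andP[FE _] /andP[F'E _] e.
    have H (X : {set {set hedge G}}) : X \subset edges G -> edges G :\: (edges G :\: X) = X.
      by move=> XE; rewrite setDDr setDv set0U (setIidPr XE).
    by rewrite -(H _ FE) e H.
  rewrite /num_odd_genus_one_decomp -(card_in_imset inj); apply: eq_card => B.
  apply/imsetP/idP => [[F]|].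
    by rewrite inE odd_genus_one_decompE => /andP[_ ?] ->.
  move=> /andP[ou cB]; have BE : B \subset edges G by case/and3P: ou.
  exists (edges G :\: B); last by rewrite setDDr setDv set0U (setIidPr BE).
  by rewrite inE odd_genus_one_decompE subsetDl /= setDDr setDv set0U (setIidPr BE) ou cB.
transitivity (\sum_(B | odd_unicyclic B)
    \sum_(1 <= r < (genus G).+1 | r == #|components B|) 4 ^ r)%N.
  rewrite (exchange_big_dep (fun B => odd_unicyclic B)) //=; last by move=> r B _ /andP[].
  apply: eq_bigr => B ou; rewrite [RHS]big_nat_cond [LHS]big_nat_cond; apply: eq_bigl => r.
  by rewrite ou [r == _]eq_sym.
apply: eq_bigr => B ou; rewrite big_nat1_eq; case: ifPn => // /negP[]; apply/andP; split.
  have /set0Pn[v0 _] : [set: vert G]%SET != set0 by case/andP: con.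
  rewrite card_gt0; apply/set0Pn; exists (pblock (components B) v0).
  exact: pblock_component.
have /and3P[BE _ _] := ou; pose F := edges G :\: B.
have BF : edges G :\: F = B by rewrite setDDr setDv set0U (setIidPr BE).
have : odd_genus_one_decomp p #|components B| F.
  by rewrite odd_genus_one_decompE BF ou eqxx subsetDl.
move=> /and4P[_ /eqP <- _ _]; rewrite ltnS -{1}BF; exact: card_components.
Qed.

End Cover.

(** * The kernel of the norm map *)

(** The image of X is listed without repetition, and X is counted fibre by fibre over that
list; Y may be infinite. *)
Lemma card_two_to_one (T : finType) (Y : eqType) (S : set Y) (g : T -> Y) (X : {set T}) n :
  (forall y, S y <-> exists2 t, t \in X & g t = y) ->
  (forall t, t \in X -> #|[set t' in X | g t' == g t]%SET| = 2%N) ->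
  #|X| = (2 * n)%N -> (S #= `I_n)%card.
Proof.
move=> SP fib Xn; pose s := undup (map g (enum X)).
have sP y : y \in s <-> S y.
  rewrite mem_undup; split=> [/mapP[t tX ->]|/SP[t tX <-]].
    by apply/SP; exists t => //; rewrite mem_enum in tX.
  by rewrite map_f // mem_enum.
have us : uniq s := undup_uniq _.
have -> : n = size s.
  have : #|X| = (\sum_(y <- s) #|[set t' in X | g t' == y]%SET|)%N.
    rewrite -sum1_card.
    rewrite [RHS](eq_bigr (fun y => \sum_(t in X) (g t == y))%N); last first.
      move=> y _; rewrite -sum1_card big_mkcond [RHS]big_mkcond; apply: eq_bigr => t _.
      by rewrite inE; case: (t \in X) => //=; case: eqP.
    rewrite exchange_big; apply: eq_bigr => t tX /=.
    rewrite (bigD1_seq (g t)) //=; last by apply/sP/SP; exists t.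
    by rewrite eqxx big1 // => y; rewrite eq_sym => /negPf ->.
  rewrite (eq_big_seq (fun=> 2%N)) => [|y /sP/SP[t tX <-]]; last exact: fib.
  rewrite big_const_seq count_predT iter_addn_0 Xn; lia.
apply/card_set_bijP; exists (index^~ s); split.
- by move=> y /sP ys; rewrite /mkset /= index_mem.
- by move=> y z /set_mem/sP ys /set_mem/sP zs; apply: index_inj.
move=> i /= si; case es: s => [|y0 s']; first by rewrite es in si.
rewrite -es; exists (nth y0 s i); first by apply/sP; rewrite mem_nth.
exact: index_uniq.
Qed.

Lemma ffunBE (T : finType) (x y : {ffun T -> int}) v : (x - y) v = x v - y v.
Proof. by rewrite !ffunE. Qed.

Section KerNm.
Variables (Gt G : mgraph) (p : free_double_cover Gt G).
Hypotheses (hGt : connected Gt) (hG : connected G).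
Local Notation iota := (sheet_swap p).
Local Notation X := {ffun vert G -> int}.

Lemma prin_div_const (H : mgraph) (a : int) :
  prin_div ([ffun _ => a] : {ffun vert H -> int}) = 0.
Proof.
by apply/ffunP => v; rewrite prin_divE big1 ?ffunE // => h _; rewrite !ffunE subrr.
Qed.

Lemma prin_div0 (H : mgraph) : prin_div (0 : {ffun vert H -> int}) = 0.
Proof. by have := @prin_divB H 0 0; rewrite !subrr. Qed.

Lemma prin_divN (H : mgraph) (f : {ffun vert H -> int}) : prin_div (- f) = - prin_div f.
Proof. by rewrite -sub0r prin_divB prin_div0 sub0r. Qed.

Lemma Nm0_liftP (D : Div Gt) : NmDiv p D = 0 -> exists x, D = lift p x.
Proof. by move=> /Nm0_lift ->; eexists. Qed.

Lemma lift_inj : injective (lift p).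
Proof. by move=> x y e; apply/ffunP => v; rewrite -!(lift_base_lift p) e. Qed.

Lemma vertex_exists : exists v : vert G, true.
Proof.
have /set0Pn[v0 _] : [set: vert G]%SET != set0 by case/andP: hG.
by exists v0.
Qed.

Lemma signed_laplacianN x : signed_laplacian p (- x) = - signed_laplacian p x.
Proof.
apply/ffunP => v; rewrite !ffunE -sumrN; apply: eq_bigr => h _.
by rewrite !ffunE mulrN opprB addrC opprK.
Qed.

Lemma signed_laplacian0 : signed_laplacian p 0 = 0.
Proof.
by apply/ffunP => v; rewrite !ffunE big1 // => h _; rewrite !ffunE mulr0 subrr.
Qed.

Lemma signed_laplacian_eq0 x : signed_laplacian p x = 0 -> x = 0.
Proof.
move=> x0; have : prin_div (lift p x) = 0.
  by rewrite prin_div_lift x0; apply/ffunP => u; rewrite !ffunE mulr0 oppr0.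
move/(harmonic_const hGt) => H; apply/ffunP => v.
have := H (base_lift p v) (iota (base_lift p v)).
by rewrite lift_swap lift_base_lift ffunE; lia.
Qed.

Let N := (\sum_(B | odd_unicyclic p B) 4 ^ #|components B|)%N.

Lemma index_signed_laplacian :
  has_index (fun x : X => exists y, x = signed_laplacian p y) N.
Proof.
pose M v w := \sum_e incidence p v e * incidence p w e.
pose f := [ffun i : 'I_#|vert G| => enum_val i].
have fE : col_submx f M =
    \matrix_(i, j) \sum_e incidence p (enum_val i) e * incidence p (enum_val j) e.
  by apply/matrixP => i j; rewrite !mxE ffunE.
have dN : \det (col_submx f M) = N%:Z by rewrite fE det_signed_laplacian.
have d0 : \det (col_submx f M) != 0.
  apply/det0P => -[y y0 yM]; case/eqP: y0.
  pose x : X := [ffun v => y 0 (enum_rank v)].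
  suff /ffunP x0 : x = 0.
    by apply/matrixP => i j; have := x0 (enum_val j); rewrite !ffunE enum_valK !mxE ord1.
  apply: signed_laplacian_eq0; apply/ffunP => v; rewrite signed_laplacianE [RHS]ffunE.
  have /matrixP/(_ 0 (enum_rank v)) := yM; rewrite !mxE => E; apply: etrans E.
  rewrite [RHS](reindex enum_rank) /=; last by apply: onW_bij; exact: enum_rank_bij.
  apply: eq_bigr => w _; rewrite mxE !ffunE !enum_rankK mulrC; congr (_ * _).
  by apply: eq_bigr => e _; rewrite mulrC.
have := index_col_submx d0; rewrite dN absz_nat => -[phi phS phP]; exists phi => // x y.
apply: iff_trans (phP x y) _; split=> -[z zE].
  exists [ffun v => z (enum_rank v)]; apply/ffunP => v; rewrite zE signed_laplacianE.
  rewrite (reindex enum_rank) /=; last by apply: onW_bij; exact: enum_rank_bij.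
  by apply: eq_bigr => w _; rewrite !ffunE enum_rankK.
exists (fun j => z (enum_val j)) => v; rewrite zE signed_laplacianE.
rewrite [RHS](reindex enum_rank) /=; last by apply: onW_bij; exact: enum_rank_bij.
by apply: eq_bigr => w _; rewrite ffunE enum_rankK.
Qed.

Lemma lift_deg0 x : (lift p x : Div Gt) \in @deg0 Gt.
Proof.
rewrite unfold_in /deg0 -(deg_NmDiv p) Nm_lift /deg big1 // => v _; exact: ffunE.
Qed.

Definition lift_class x : Jac Gt := jac_class (MkDiv0 (lift_deg0 x)).

Lemma jac_class_eq (H : mgraph) (D D' : Div0 H) : jac_class D = jac_class D' <->
  exists f, div0_val D - div0_val D' = prin_div f.
Proof.
have -> : (jac_class D = jac_class D') <-> D - D' \in @prin0 H.
  by rewrite Quotient.idealrBE; split=> [e|/eqP e]; [apply/eqP; exact: e|exact: e].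
by rewrite unfold_in /prin0; split=> [/asboolP|?]; [|apply/asboolP].
Qed.

Lemma liftN x : lift p (- x) = - lift p x.
Proof. by apply/ffunP => u; rewrite !ffunE mulrN. Qed.

(** Twice this function is the constant 1 plus the lift of the constant 1; so its
principal divisor is, in lift coordinates, half of a vector in the image of the signed
Laplacian. *)
Definition sheet_indicator : {ffun vert Gt -> int} := [ffun u => (~~ sheet p u)%:R].
Definition half_shift : X := [ffun v => prin_div sheet_indicator (base_lift p v)].

Lemma Nm_sheet_indicator : NmDiv p sheet_indicator = [ffun=> 1].
Proof. by apply/ffunP => v; rewrite NmDivE !ffunE sheet_swapN sheet_base_lift. Qed.

Lemma lift_half_shift : lift p half_shift = prin_div sheet_indicator.
Proof.
apply/esym/(Nm0_lift (D := prin_div sheet_indicator)); rewrite NmDiv_prin.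
by rewrite Nm_sheet_indicator prin_div_const.
Qed.

(** Otherwise the sheet indicator would be the sum of a constant and of an anti-invariant
function, and its norm 1 would be even. *)
Lemma half_shift_notin x : half_shift <> signed_laplacian p x.
Proof.
move=> e; have : prin_div (sheet_indicator - lift p (- x)) = 0.
  by rewrite prin_divB prin_div_lift signed_laplacianN liftN opprK -lift_half_shift e subrr.
have [v _] := vertex_exists.
move/(harmonic_const hGt)/(_ (base_lift p v) (iota (base_lift p v))).
by rewrite !ffunBE lift_swap lift_base_lift !ffunE sheet_swapN sheet_base_lift /=; lia.
Qed.

(** If the divisor of f has trivial norm, then the norm of f is harmonic, hence a constant
c.  Removing a constant function from f, and one sheet indicator if c is odd, leaves an
anti-invariant function. *)
Lemma lift_class_eq x y : lift_class x = lift_class y <->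
  (exists z, x - y = signed_laplacian p z) \/
  (exists z, x - y - half_shift = signed_laplacian p z).
Proof.
apply: iff_trans (jac_class_eq _ _) _ => /=; split.
  move=> [f]; rewrite -liftB => fE.
  have : prin_div (NmDiv p f) = 0 by rewrite -NmDiv_prin -fE Nm_lift.
  move/(harmonic_const hG) => cst; have [v0 _] := vertex_exists.
  pose c := NmDiv p f v0.
  have Nmc a : NmDiv p ([ffun=> a] : Div Gt) = [ffun=> a + a].
    by apply/ffunP => v; rewrite NmDivE !ffunE.
  have [k [b cE]] : exists k (b : bool), c = k + k + b%:R.
    by exists (c %/ 2)%Z, (c %% 2 == 1)%Z; lia.
  have : NmDiv p (f - [ffun=> k] - (if b then sheet_indicator else 0)) = 0.
    have -> : NmDiv p (f - [ffun=> k] - (if b then sheet_indicator else 0)) =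
              NmDiv p f - [ffun=> k + k] - [ffun=> b%:R].
      rewrite !NmDivB Nmc; congr (_ - _); case: (b); first exact: Nm_sheet_indicator.
      by apply/ffunP => v; rewrite NmDivE !ffunE.
    apply/ffunP => v; rewrite !ffunBE (cst v v0) -/c cE !ffunE; lia.
  move=> /Nm0_liftP[z]; move/(congr1 (@prin_div Gt)).
  rewrite prin_div_lift !prin_divB prin_div_const subr0 -fE => zE.
  case: b cE zE => _ zE; [right|left]; exists (- z); apply: lift_inj;
    rewrite signed_laplacianN liftN -zE.
    by rewrite [LHS]liftB lift_half_shift.
  by rewrite prin_div0 subr0.
case=> -[z zE].
  by exists (lift p (- z)); rewrite prin_div_lift signed_laplacianN liftN opprK -zE liftB.
exists (sheet_indicator - lift p z).
rewrite prin_divB prin_div_lift opprK -lift_half_shift -zE.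
by rewrite -liftB [lift p (_ - half_shift)]liftB [RHS]addrC subrK.
Qed.

Definition even_vec (x : X) : bool := (2 %| \sum_v x v)%Z.

(** The two half-edges of an edge contribute the same multiple, 0 or 2, of a sum of values. *)
Lemma even_signed_laplacian x : even_vec (signed_laplacian p x).
Proof.
rewrite /even_vec (eq_bigr (fun v => \sum_(h | root h == v)
  (x (root h) - (-1) ^+ crossing p h * x (root (flip h))))).
  rewrite -(@partition_big _ _ _ _ _ _ xpredT (@root G) xpredT) //= sum_hedges.
  apply: rpred_sum => e _.
  case: pickP => // h _; rewrite crossing_flip flipK.
  have -> (a b s : int) : a - s * b + (b - s * a) = (1 - s) * (a + b) by lia.
  by apply: dvdz_mulr; case: (crossing p h).
by move=> v _; rewrite ffunE; apply: eq_bigr => h /eqP ->.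
Qed.

(** The sum is minus the number of half-edges of crossing edges. *)
Lemma even_half_shift : even_vec half_shift.
Proof.
rewrite /even_vec (eq_bigr (fun v => \sum_(h | root h == v) - (crossing p h)%:R)).
  rewrite -(@partition_big _ _ _ _ _ _ xpredT (@root G) xpredT) //= sum_hedges.
  apply: rpred_sum => e _.
  by case: pickP => // h _; rewrite crossing_flip; case: (crossing p h).
move=> v _; rewrite ffunE prin_divE -[in RHS](pV_base_lift p v).
rewrite -(sum_star p _ (fun h => - (crossing p h)%:R)).
apply: eq_bigr => k /eqP ks; rewrite crossingE ks sheet_base_lift !ffunE sheet_base_lift /=.
by case: (sheet p _).
Qed.

Lemma even_vecB x y : even_vec (x - y) = (even_vec x == even_vec y).
Proof. by rewrite /even_vec sum_ffunB dvd2B. Qed.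

Lemma even_lift_class x y : lift_class x = lift_class y -> even_vec x = even_vec y.
Proof.
move=> /lift_class_eq[] [z zE]; have := even_signed_laplacian z; rewrite -zE !even_vecB.
  by move/eqP.
by rewrite even_half_shift eqb_id => /eqP.
Qed.

(** In D = E - iota E the degree of E has the parity of the sum of D over one sheet; E is
the positive part of D. *)
Lemma has_parityE x b : has_parity p (lift p x : Div Gt) b <-> b = ~~ even_vec x.
Proof.
have par (E : Div Gt) : lift p x = E - iota_div p E -> odd `|deg E|%N = ~~ even_vec x.
  move=> xE; rewrite /even_vec.
  have -> : \sum_v x v = deg E - 2 * \sum_v E (iota (base_lift p v)).
    rewrite /deg (sum_vert_cover p E) mulr_sumr -sumrB; apply: eq_bigr => v _.
    rewrite -(lift_base_lift p x) xE ffunBE [iota_div _ _ _]ffunE; lia.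
  by rewrite dvd2B dvdz_mulr // eqb_id; lia.
split=> [[E [_ _ xE ->]]|->]; first exact: par.
pose E : Div Gt := [ffun u => Num.max 0 (lift p x u)].
have xE : lift p x = E - iota_div p E.
  by apply/ffunP => u; rewrite ffunBE [iota_div _ _ _]ffunE ![E _]ffunE lift_swap; lia.
exists E; split=> //; last by rewrite par.
  by move=> u; rewrite ffunE; lia.
by move=> u; rewrite [iota_div _ _ _]ffunE ![E _]ffunE lift_swap; lia.
Qed.

(** Any class in the kernel has a representative of trivial norm: subtract a principal
divisor whose norm is that of the given representative. *)
Lemma KerNmP y : KerNm p y <-> exists x, lift_class x = y.
Proof.
have jac0 : jac_class (0 : Div0 G) = 0.
  exact: (@pi_zeror _ _ _ _ _ (Quotient.quot (@prin0 G))).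
split=> [y0|[x <-]]; last first.
  rewrite /KerNm /= Nm_class -jac0; congr jac_class; apply: val_inj => /=; exact: Nm_lift.
pose D : Div0 Gt := repr (y : Quotient.quot (@prin0 Gt)).
have yD : y = jac_class D by rewrite /jac_class reprK.
move: y0; rewrite /KerNm /= yD Nm_class -jac0 => /jac_class_eq[f /=]; rewrite subr0 => fE.
pose F : {ffun vert Gt -> int} := [ffun u => if sheet p u then 0 else f (pV p u)].
have NmF : NmDiv p F = f.
  by apply/ffunP => v; rewrite NmDivE !ffunE sheet_swapN sheet_base_lift pV_base_lift addr0.
have /Nm0_lift DF : NmDiv p (div0_val D - prin_div F) = 0.
  by rewrite NmDivB NmDiv_prin NmF fE subrr.
exists [ffun v => (div0_val D - prin_div F) (base_lift p v)]; apply/jac_class_eq => /=.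
by exists (- F); rewrite -DF prin_divN addrC addKr.
Qed.

Lemma PrymP y : Prym p y <-> exists2 x, even_vec x & lift_class x = y.
Proof.
split=> [[_ [D [<- /Nm0_liftP[x Dx] Dev]]]|[x xev <-]].
  exists x; last by rewrite /lift_class; congr jac_class; apply: val_inj; rewrite /= Dx.
  by move: Dev; rewrite Dx has_parityE; case: even_vec.
split; first by apply/KerNmP; exists x.
exists (MkDiv0 (lift_deg0 x)); split=> //=; first exact: Nm_lift.
by rewrite has_parityE xev.
Qed.

(** The N cosets of the signed Laplacian map two-to-one onto the kernel, as each fibre is
a coset together with its translate by half_shift.  Half of them are even, and they map
two-to-one onto the Prym group. *)
Lemma card_KerNm_Prym n : N = (4 * n)%N ->
  (Prym p #= `I_n)%card /\ (KerNm p #= `I_(2 * n))%card.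
Proof.
move=> Nn; have [phi phS phP] := index_signed_laplacian.
have [r rP] := fin_all_exists phS.
pose g t := lift_class (r t).
have phi_even x y : phi x = phi y -> even_vec x = even_vec y.
  by move=> /phP[z zE]; have := even_signed_laplacian z; rewrite -zE even_vecB => /eqP.
have phi_class x y : phi x = phi y -> lift_class x = lift_class y.
  by move=> /phP ?; apply/lift_class_eq; left.
have g_phi x : g (phi x) = lift_class x by apply: phi_class; rewrite rP.
have fibre t : [set t' | g t' == g t]%SET = [set t; phi (r t + half_shift)]%SET.
  apply/setP => t'; rewrite !inE; apply/eqP/orP => [/lift_class_eq[]|[] /eqP -> //].
  - by move=> H; left; rewrite -(rP t') -(rP t); apply/eqP/phP.
  - by move=> H; right; rewrite -(rP t'); apply/eqP/phP; rewrite opprD addrA.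
  rewrite g_phi; apply/lift_class_eq; right; exists 0.
  by rewrite addrAC addrK subrr signed_laplacian0.
have tne t : t != phi (r t + half_shift).
  apply/eqP; rewrite -{1}(rP t) => /esym/phP[z]; rewrite addrAC subrr add0r.
  exact: half_shift_notin.
pose Ev := [set t | even_vec (r t)]%SET.
have g_even t t' : g t' = g t -> (t' \in Ev) = (t \in Ev).
  by rewrite !inE => /even_lift_class.
split.
  apply: (card_two_to_one (g := g) (X := Ev)).
  - move=> y; apply: iff_trans (PrymP y) _; split=> [[x xev <-]|[t]].
      by exists (phi x); rewrite ?g_phi // inE (phi_even _ x) ?rP.
    by rewrite inE => tev <-; exists (r t).
  - move=> t tE; have -> : [set t' in Ev | g t' == g t]%SET = [set t' | g t' == g t]%SET.
      by apply/setP => t'; rewrite !inE andbC; case: eqP => //= /g_even; rewrite tE inE => ->.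
    by rewrite fibre cards2 tne.
  (* Subtracting a vertex exchanges the even and the odd classes. *)
  have [v0 _] := vertex_exists; pose d : X := [ffun v => (v == v0)%:R].
  have odd_d : even_vec d = false.
    rewrite /even_vec (bigD1 v0) //= big1 ?addr0 ?ffunE ?eqxx // => v /negPf vv.
    by rewrite ffunE vv.
  have even_d x : even_vec (x - d) = ~~ even_vec x by rewrite even_vecB odd_d; case: even_vec.
  pose tr t := phi (r t - d).
  have tr_inj : injective tr.
    move=> t t' /phP[z zE]; rewrite -(rP t) -(rP t'); apply/phP; exists z.
    by rewrite -zE opprB addrA subrK.
  have trE t : (tr t \in Ev) = (t \notin Ev).
    by rewrite !inE (phi_even _ (r t - d)) ?rP.
  have : #|Ev| = #|~: Ev|.
    apply/eqP; rewrite eqn_leq; apply/andP; split; rewrite -[leqLHS](card_imset _ tr_inj);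
      apply: subset_leq_card; apply/subsetP => _ /imsetP[t tE ->].
      by rewrite inE trE negbK.
    by rewrite trE -in_setC.
  by have := etrans (cardsC Ev) (etrans (card_ord N) Nn) => + half; rewrite -half; lia.
apply: (card_two_to_one (g := g) (X := setT)).
- move=> y; apply: iff_trans (KerNmP y) _; split=> [[x <-]|[t _ <-]]; last by exists (r t).
  by exists (phi x); rewrite ?inE ?g_phi.
- move=> t _; have -> : [set t' in setT | g t' == g t]%SET = [set t' | g t' == g t]%SET.
    by apply/setP => t'; rewrite !inE.
  by rewrite fibre cards2 tne.
by rewrite cardsT card_ord Nn; lia.
Qed.

End KerNm.

Local Close Scope ring_scope.

Theorem mainTheorem1 (Gt G : mgraph) (p : free_double_cover Gt G)
    (hGt : connected Gt) (hG : connected G) :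
  exists n : nat,
    [/\ (Prym p #= `I_n)%card,
        (KerNm p #= `I_(2 * n))%card &
        n = (\sum_(1 <= r < (genus G).+1)
               4 ^ (r - 1) * num_odd_genus_one_decomp p r)%N].
Proof.
set n := (\sum_(_ <= r < _) _)%N; exists n.
by have [] := card_KerNm_Prym hGt hG (esym (sum_odd_genus_one_decomp p hG)).
Qed.
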